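(* Let $t\ge 2$ and $\lambda\ge 0$. Then $$G_{t,\mathcal P}(\lambda)=\begin{cases}1 & \text{if }\lambda\le 1-\frac2t;\\[1mm] \frac18\Big(4+t^2-2\lambda t^2+\lambda^2t^2+4t(1-\lambda)\log\Big(\frac{2}{t(1-\lambda)}\Big)\Big) & \text{if }1-\frac2t\le\lambda<1;\\[1mm] \frac18\Big(4-t^2+2\lambda t^2-\lambda^2t^2-4t(\lambda-1)\log\Big(\frac{2}{t(\lambda-1)}\Big)\Big) & \text{if }1\le\lambda<1+\frac2t;\\[1mm] 0 & \text{if }1+\frac2t\le\lambda,\end{cases}$$ where at $\lambda=1$ the expression $(\lambda-1)\log\frac{2}{t(\lambda-1)}$ is understood as its limit $0$.
   Context: Let $h$ be a non-zero integer and $p>|h|$ an odd prime, and put $J=J_p=(p-1)/2$. For a residue class $a$ mod $p$ let $[a]$ denote its representative in $[-J,J]$. Let $$\mathcal A(p,h)=\big\{([n^{-1}],[(n+h)^{-1}]):\ n\in\mathbb Z/p\mathbb Z,\ n\not\equiv 0,\ n+h\not\equiv 0 \pmod p\big\}\subseteq[-J,J]^2,$$ where inverses are taken modulo $p$. It has $N=N(p,h)=p-2$ elements. Fix $t>0$ and place an observer at $P_{t,J}=(-tJ^2,0)$ ($p$ is large enough that $tJ>1$). For each point $P\in\mathcal A(p,h)$ consider the signed angle between the ray from $P_{t,J}$ to $P$ and the positive direction of the $x$-axis (negative if $P$ lies below the $x$-axis). Label these angles, with multiplicity, in ascending order $\alpha_1\le\alpha_2\le\dots\le\alpha_N$. The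 average gap is $\Delta_{av}=(\alpha_N-\alpha_1)/(N-1)$, and the gap-distribution function is $$G_{t,p,h}(\lambda)=\frac{1}{N-1}\#\big\{j\in\{1,\dots,N-1\}:\ \alpha_{j+1}-\alpha_j\ge\lambda\Delta_{av}\big\}.$$ The limiting gap distribution is $G_{t,\mathcal P}(\lambda)=\lim_{p\to\infty,\ p\text{ prime}}G_{t,p,h}(\lambda)$; the limit exists and is independent of the choice of the fixed non-zero integer $h$. *)

(* Defs.v *)
From HB Require Import structures.
From mathcomp Require Import all_boot all_order all_algebra.
From mathcomp Require Import all_classical all_reals all_analysis.

Set Implicit Arguments.
Unset Strict Implicit.
Unset Printing Implicit Defensive.

Import Order.TTheory GRing.Theory Num.Theory.
Import numFieldNormedType.Exports.

Local Open Scope ring_scope.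

(** Everything below is total in [p : nat] and meaningful only for [p] an odd
    prime: ['F_p] is Z/pZ only when [p] is prime. *)

Definition half (p : nat) : nat := p.-1./2.

Definition symrep (p : nat) (a : 'F_p) : int :=
  if (val a <= half p)%N then (val a)%:Z else (val a)%:Z - p%:Z.

(** The set A(p, h), listed by [n]; by [points_uniq] each point occurs once. *)
Definition points (p : nat) (h : int) : seq (int * int) :=
  [seq (symrep n^-1, symrep (n + h%:~R)^-1)
     | n <- enum 'F_p & (n != 0) && (n + h%:~R != 0)].

(** Signed angle between the nonzero vector (u, v) and the vector (1, 0): the
    angle between two vectors is the arccosine of their normalized dot product,
    and the sign is negative below the x-axis. *)
Definition signed_angle (R : realType) (u v : R) : R :=
  let theta := acos (u / Num.sqrt (u ^+ 2 + v ^+ 2)) in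
  if v < 0 then - theta else theta.

Definition observer (R : realType) (t : R) (p : nat) : R * R :=
  (- (t * (half p)%:R ^+ 2), 0).

Definition view_angle (R : realType) (t : R) (p : nat) (P : int * int) : R :=
  signed_angle (P.1%:~R - (observer t p).1) (P.2%:~R - (observer t p).2).

(** 0-based: [(angles t p h)`_j] is alpha_(j+1). *)
Definition angles (R : realType) (t : R) (p : nat) (h : int) : seq R :=
  sort <=%R [seq view_angle t p P | P <- points p h].

Definition average_gap (R : realType) (t : R) (p : nat) (h : int) : R :=
  let N := size (points p h) in
  let alpha := angles t p h in
  (alpha`_N.-1 - alpha`_0) / (N.-1)%:R.

Definition gap_distribution (R : realType) (t : R) (p : nat) (h : int)
    (lambda : R) : R :=
  let N := size (points p h) in
  let alpha := angles t p h in
  #|[set j : 'I_N.-1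
       | lambda * average_gap t p h <= alpha`_j.+1 - alpha`_j]|%:R / (N.-1)%:R.

Lemma symrep_inj (p : nat) : prime p -> injective (@symrep p).
Proof.
move=> p_pr a b; rewrite /symrep => ab; apply: val_inj => /=.
have lt (c : 'F_p) : (val c < p)%N by have := ltn_ord c; rewrite [X in (_ < X)%N](Fp_cast p_pr).
have hb (c : 'F_p) : (val c)%:Z - p%:Z < 0 by rewrite subr_lt0 ltz_nat.
case: ifP ab => _; case: ifP => _ ab.
- by case: ab.
- by have := hb b; rewrite -ab.
- by have := hb a; rewrite ab.
- by case: (addIr _ ab).
Qed.

Lemma points_uniq (p : nat) (h : int) : prime p -> uniq (points p h).
Proof.
move=> p_pr; rewrite map_inj_in_uniq ?filter_uniq -?enumT ?enum_uniq //.
by move=> m n _ _ [/(symrep_inj p_pr)/invr_inj].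
Qed.

Lemma size_points (p : nat) (h : int) : prime p -> (h%:~R != 0 :> 'F_p) ->
  size (points p h) = (p - 2)%N.
Proof.
move=> p_pr h0; rewrite size_map.
have -> : [seq n <- enum 'F_p | (n != 0) && (n + h%:~R != 0)]
    = enum (~: [set 0; - h%:~R] : {set 'F_p}).
  rewrite !enumT [RHS]/enum_mem; apply: eq_filter => n.
  by rewrite !inE negb_or addr_eq0.
by rewrite -cardE cardsCs finset.setCK cards2 eq_sym oppr_eq0 h0 card_Fp.
Qed.

(* Main.v *)
From mathcomp Require Import all_boot all_order all_algebra.
From mathcomp Require Import all_classical all_reals all_analysis.
From mathcomp Require Import complex ring lra zify.
Require Import Defs.

Set Implicit Arguments.
Unset Strict Implicit.
Unset Printing Implicit Defensive.

Import Order.TTheory GRing.Theory Num.Theory.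
Import numFieldNormedType.Exports.
Local Open Scope ring_scope.

(** Writing y = (n + h)^-1, each point of A(p, h) is (xi y, y) with xi a Moebius
    map, and t J^2 times the angle of that point is y - y xi(y) / (t J^2) + O(1 / J).
    As t >= 2, this is monotone in y up to O(1 / J), so that the gaps are
      1 - [y] ([xi (y + 1)] - [xi y]) / (t J^2) + O(1 / J)
    apart from the two missing ordinates. Hence G(lambda) tends to the probability
    that u (w - v) <= t (1 - lambda) for u, v, w uniform in [-1, 1], once the triples
    (y, xi y, xi (y + 1)) are equidistributed in the cube.

    The equidistribution rests on a nontrivial bound for
      S = \sum_x psi (a / x + b / (x - 1) + c x).
    Grouping the pairs in S^2 by sum and product splits it into Kloosterman sums,
    bounded by their second moment, and a sum twisted by the quadratic character
    eta. With s = 2 / (1 + u), v = (1 + m) / (1 + u) the latter is the bilinear form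
      \sum_(u, m) eta (- (m + u m + u)) al(u) be(m) K(u / m),
    and two applications of Cauchy-Schwarz eliminate al, be and K, leaving complete
    sums of eta over quartics whose mean square is elementary. *)

(** * The quadratic character *)

(** The limit carries no rate, so a saving of o(q) in the character sum is enough, and elementary
    second moments can replace the Weil bound. The saving is a free [delta], subject only to
    [7 <= delta ^+ 4 * q]; all thresholds for the curve are uniform in the residue of h, since h^-1
    moves with p.

    The region u (w - v) >= nu J^2 is not a box, and its Fourier coefficients are avoided: the curve
    is convolved with a small cube [B], of which Parseval needs only the cardinality. The price is
    that the region grows by [B], which costs a small decrease of nu, and that residues near the
    edge of [-J, J] wrap around, which costs a thin [border].

    This yields upper bounds only. They suffice, because large gaps and small gaps fall, up to a
    small margin, in two complementary regions whose limiting probabilities [tail_prob nu] and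
    [tail_prob (- nu)] add up to 1: the upper bound for one is the lower bound for the other. *)

Section QuadraticCharacter.
Variable F : finFieldType.
Hypothesis two_neq0 : (2 : F) != 0.
Implicit Types (x y z d s v : F).
Local Notation q := (#|F|%:Z).

Lemma card_field_gt0 : (0 < #|F|)%N.
Proof. by apply/card_gt0P; exists 0. Qed.

Definition eta x : int :=
  if x == 0 then 0 else if [exists y, y ^+ 2 == x] then 1 else -1.

Lemma eta0 : eta 0 = 0. Proof. by rewrite /eta eqxx. Qed.

Lemma eta_sqr x : x != 0 -> eta (x ^+ 2) = 1.
Proof.
move=> x0; rewrite /eta expf_eq0 /= (negPf x0).
by case: existsP => // -[]; exists x.
Qed.

Lemma eta_le1 x : `|eta x| <= 1.
Proof. by rewrite /eta; case: ifP => // _; case: ifP. Qed.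

Lemma neqN x : x != 0 -> - x != x.
Proof.
move=> x0; rewrite -subr_eq0 -opprD oppr_eq0 -mulr2n -mulr_natl.
by rewrite mulf_neq0.
Qed.

Lemma card_sqrt z : #|[pred y | y ^+ 2 == z]|%:Z = 1 + eta z.
Proof.
rewrite /eta; case: eqVneq => [->|z0].
  by rewrite addr0 (@fintype.eq_card1 _ 0) // => y; rewrite !inE expf_eq0.
case: ifP => [/existsP[y /eqP yz]|/existsPn none]; last first.
  by rewrite fintype.eq_card0 // => y; rewrite !inE; apply/negbTE/none.
have y0 : y != 0 by apply: contraNneq z0 => y0; rewrite -yz y0 expf_eq0 eqxx.
rewrite (@fintype.eq_card _ _ (pred2 y (- y))) ?card2.
  by rewrite eq_sym neqN.
by move=> x; rewrite !inE -yz eqf_sqr.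
Qed.

Lemma sum_sqr (V : zmodType) (f : F -> V) :
  \sum_x f (x ^+ 2) = \sum_z f z *~ (1 + eta z).
Proof.
rewrite (partition_big (fun x => x ^+ 2) predT) //=; apply: eq_bigr => z _.
rewrite (eq_bigr (fun=> f z)) => [|x /eqP-> //].
by rewrite sumr_const -card_sqrt pmulrn.
Qed.

Lemma sum_eta : \sum_x eta x = 0.
Proof.
have : \sum_(x : F) 1 = \sum_x (1 + eta x) :> int.
  rewrite (sum_sqr (fun=> 1 : int)).
  by apply: eq_bigr => z _; rewrite intz.
rewrite big_split /= => /eqP; rewrite -[X in X == _]addr0 (inj_eq (addrI _)).
by rewrite eq_sym => /eqP.
Qed.

Lemma eta_mul_sqr x y : x != 0 -> eta (x ^+ 2 * y) = eta y.
Proof.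
move=> x0; rewrite /eta mulf_eq0 expf_eq0 /= (negPf x0) /=.
case: ifP => // _; congr (if _ then _ else _).
apply/existsP/existsP => -[w /eqP wE].
  by exists (w / x); rewrite expr_div_n wE mulrC mulKf ?expf_neq0.
by exists (x * w); rewrite exprMn wE.
Qed.

Lemma eta_cases x : x != 0 -> (exists2 y, y != 0 & x = y ^+ 2) \/ eta x = -1.
Proof.
move=> x0; rewrite /eta (negPf x0); case: ifP => [/existsP[y /eqP yx]|_]; last by right.
by left; exists y => //; apply: contraNneq x0 => y0; rewrite -yx y0 expf_eq0 eqxx.
Qed.

(* For a nonsquare [x], the sum of [eta y + eta (x * y)] over [y] vanishes
   although every term is nonpositive. *)
Lemma etaM x y : eta (x * y) = eta x * eta y.
Proof.
have [->|x0] := eqVneq x 0; first by rewrite mul0r eta0 mul0r.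
have [->|y0] := eqVneq y 0; first by rewrite mulr0 eta0 mulr0.
have [[w w0 ->]|ex] := eta_cases x0.
  by rewrite eta_mul_sqr // eta_sqr // mul1r.
have le0 z : 0 <= - (eta z + eta (x * z)).
  have [->|z0] := eqVneq z 0; first by rewrite mulr0 eta0.
  have [[w w0 ->]|ez] := eta_cases z0.
    by rewrite (mulrC x) eta_mul_sqr // ex eta_sqr.
  by rewrite ez oppr_ge0; have := eta_le1 (x * z); rewrite ler_norml; lia.
have : \sum_z - (eta z + eta (x * z)) == 0.
  rewrite sumrN big_split /= sum_eta add0r oppr_eq0.
  by rewrite -[X in X == _](reindex_inj (mulfI x0) (P := xpredT)) /= sum_eta.
rewrite psumr_eq0 // => /allP/(_ y (mem_index_enum _))/implyP/(_ isT)/eqP.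
by rewrite ex; lia.
Qed.

Lemma eta_sq1 x : x != 0 -> eta x * eta x = 1.
Proof. by move=> x0; rewrite -etaM -expr2 eta_sqr. Qed.

Lemma four_neq0 : (4 : F) != 0.
Proof. by have -> : (4 : F) = 2 * 2; [ring | rewrite mulf_neq0]. Qed.

Lemma card_quad_roots s v : #|[pred x | x * (s - x) == v]|%:Z = 1 + eta (s ^+ 2 - 4 * v).
Proof.
rewrite -card_sqrt; congr Posz.
have inj : injective (fun x => 2 * x - s).
  by move=> x y /addIr/(mulfI two_neq0).
rewrite -[RHS](on_card_preimset (f := fun x => 2 * x - s)) /=; last first.
  apply: onW_bij; exact: (injF_bij inj).
apply: fintype.eq_card => x; rewrite !inE /=.
have -> : ((2 * x - s) ^+ 2 == s ^+ 2 - 4 * v) = (4 * (x * (s - x)) == 4 * v).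
  by rewrite -subr_eq0 -[RHS]subr_eq0 -[RHS]oppr_eq0; congr (_ == 0); ring.
by rewrite (inj_eq (mulfI four_neq0)).
Qed.

Lemma sum_quad (V : zmodType) (f : F -> V) s :
  \sum_x f (x * (s - x)) = \sum_v f v *~ (1 + eta (s ^+ 2 - 4 * v)).
Proof.
rewrite (partition_big (fun x => x * (s - x)) predT) //=; apply: eq_bigr => z _.
rewrite (eq_bigr (fun=> f z)) => [|x /eqP-> //].
by rewrite sumr_const -card_quad_roots pmulrn.
Qed.

(** For [d != 0] the inversion z -> z^-1 turns the summand into [eta (1 + d * z)] up to a square
    factor; the complete sum of [eta] vanishes, and only its term at z = 0, equal to 1, is
    missing. *)
Lemma eta_corr d :
  \sum_z eta z * eta (z + d) = if d == 0 then q - 1 else -1.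
Proof.
rewrite (bigD1 0) //= eta0 mul0r add0r.
case: eqVneq => [->|d0].
  rewrite (eq_bigr (fun=> 1)) => [|z z0]; last by rewrite addr0 eta_sq1.
  by rewrite sumr_const cardC1 -subn1 natrB ?card_field_gt0 // natz.
transitivity (\sum_(z | z != 0) eta (1 + d * z)).
  rewrite (reindex_inj invr_inj) /=; apply: eq_big => [z|z z0].
    by rewrite invr_eq0.
  rewrite invr_eq0 in z0; rewrite -etaM -[RHS](@eta_mul_sqr z^-1) ?invr_eq0 //.
  by congr eta; field.
have := sum_eta; rewrite (reindex_inj (addrI 1)) /= (reindex_inj (mulfI d0)) /=.
rewrite (bigD1 0) //= mulr0 addr0 -(expr1n _ 2) eta_sqr ?oner_eq0 //.
by rewrite expr1n => /eqP; rewrite addrC addr_eq0 => /eqP.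
Qed.

Lemma eta_corr1 : \sum_z eta (z * (z - 1)) = -1.
Proof.
under eq_bigr => z _ do rewrite etaM.
by rewrite eta_corr oppr_eq0 oner_eq0.
Qed.

Lemma eta_corr2 x y : \sum_n eta (n + x) * eta (n + y) = (x == y)%:R * q - 1.
Proof.
rewrite (reindex_inj (addIr (- x))) /=.
under eq_bigr => n _ do rewrite subrK -addrA (addrC (- x)).
rewrite eta_corr subr_eq0 eq_sym; case: eqP => _; by rewrite ?mul1r ?mul0r ?add0r.
Qed.

(** The sums to which the quartic sums [etaJ] reduce. As [n] enters through a single shift, their
    mean square follows from the correlations of [eta]. *)
Definition etaL n := \sum_v eta (v * (v - 1)) * eta (n + 4 * v).

Lemma sum_etaL_sqr : \sum_n etaL n ^+ 2 <= q ^+ 2.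
Proof.
pose e v := eta (v * (v - 1)).
have f4 := four_neq0.
have -> : \sum_n etaL n ^+ 2 = q * (\sum_v e v ^+ 2) - (\sum_v e v) ^+ 2.
  transitivity (\sum_v \sum_w e v * e w * ((v == w)%:R * q - 1)).
    under eq_bigr => n _ do rewrite expr2 /etaL big_distrlr /=.
    rewrite exchange_big /=; apply: eq_bigr => v _.
    rewrite exchange_big /=; apply: eq_bigr => w _.
    rewrite -(inj_eq (mulfI f4)) -eta_corr2 mulr_sumr.
    by apply: eq_bigr => n _; rewrite /e; ring.
  rewrite (expr2 (\sum_v _)) big_distrlr /= mulr_sumr -sumrB.
  apply: eq_bigr => v _.
  rewrite (eq_bigr (fun w => e v * e w * ((v == w)%:R * q) - e v * e w)).
    rewrite sumrB; congr (_ - _).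
    rewrite (bigD1 v) //= eqxx big1 => [|w]; first by rewrite addr0 /=; ring.
    by rewrite eq_sym => /negPf->; rewrite mul0r mulr0.
  by move=> w _; ring.
have : \sum_v e v ^+ 2 <= q.
  rewrite -[leRHS]natz -sumr_const; apply: ler_sum => v _.
  by rewrite -real_normK ?num_real // expr_le1 // eta_le1.
have : 0 <= (\sum_v e v) ^+ 2 by rewrite exprn_even_ge0.
by have : 0 <= q by []; nia.
Qed.

Lemma sum_two_to_one (K : numDomainType) (P : pred F) (phi : F -> F) (g : F -> K) :
  (forall n, 0 <= g n) ->
  (forall n, (#|[pred d | P d & phi d == n]| <= 2)%N) ->
  \sum_(d | P d) g (phi d) <= 2 * \sum_n g n.
Proof.
move=> g0 fib; rewrite (partition_big phi predT) //= mulr_sumr.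
apply: ler_sum => n _; rewrite (eq_bigr (fun=> g n)) => [|d /andP[_ /eqP-> //]].
rewrite sumr_const -[leLHS]mulr_natl ler_wpM2r // (ler_nat _ _ 2).
by apply: leq_trans (fib n); apply: subset_leq_card; apply/fintype.subsetP.
Qed.

Definition etaJ d := \sum_z eta (z * (z - 1) * ((z + d) * (z + d - 1))).

(** The four factors pair up as z (z + d - 1) and (z - 1) (z + d), both functions of v = z (1 - d -
    z): they equal - v and - (v + d). Counting the z above each v gives the weight 1 + eta of the
    discriminant, and rescaling v by - d turns the eta part into [etaL]. *)
Lemma etaJE d : d != 0 -> etaJ d = -1 + eta d * etaL ((d - 1) ^+ 2 / d).
Proof.
move=> d0; rewrite -eta_corr1 /etaJ.
transitivity (\sum_v eta (v * (v + d)) *~ (1 + eta ((1 - d) ^+ 2 - 4 * v))).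
  by rewrite -sum_quad; apply: eq_bigr => z _; congr eta; ring.
have nd0 : - d != 0 by rewrite oppr_eq0.
rewrite (reindex_inj (mulfI nd0)) /= /etaL mulr_sumr -big_split /=.
apply: eq_bigr => v _.
have -> : - d * v * (- d * v + d) = d ^+ 2 * (v * (v - 1)) by ring.
rewrite eta_mul_sqr // mulrzz mulrDr mulr1; congr (_ + _).
rewrite [RHS]mulrCA -(etaM d); congr (_ * eta _); by field.
Qed.

(** 7 = 1 + 2 + 4: the term [d = 0] is bounded trivially, and elsewhere the square is at most 2 + 2
    L^2, where the argument of [etaL] takes each value at most twice. *)
Lemma sum_etaJ_sqr : \sum_d etaJ d ^+ 2 <= 7 * q ^+ 2.
Proof.
have q1 : 1 <= q by rewrite lez_nat card_field_gt0.
have bnd d : etaJ d ^+ 2 <= q ^+ 2.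
  rewrite -real_normK ?num_real // ler_sqr ?nnegrE // /etaJ.
  apply: le_trans (ler_norm_sum _ _ _) _.
  by rewrite -[leRHS]natz -sumr_const; apply: ler_sum => v _; apply: eta_le1.
rewrite (bigD1 0) //=.
have le2 : \sum_(d | d != 0) etaJ d ^+ 2
    <= \sum_(d : F | d != 0) 2 + 2 * \sum_(d | d != 0) etaL ((d - 1) ^+ 2 / d) ^+ 2.
  rewrite mulr_sumr -big_split /=; apply: ler_sum => d d0.
  rewrite etaJE //; set L := etaL _.
  have : (eta d * L) ^+ 2 = L ^+ 2 by rewrite exprMn expr2 eta_sq1 ?mul1r.
  by nia.
have le3 : \sum_(d | d != 0) etaL ((d - 1) ^+ 2 / d) ^+ 2 <= 2 * q ^+ 2.
  apply: le_trans (_ : 2 * \sum_n etaL n ^+ 2 <= _); last first.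
    by rewrite ler_wpM2l // sum_etaL_sqr.
  apply: (@sum_two_to_one _ _ (fun d => (d - 1) ^+ 2 / d) (fun n => etaL n ^+ 2)).
    by move=> n; rewrite exprn_even_ge0.
  move=> n; rewrite -lez_nat.
  (* The fibre over [n] consists of roots of d (n + 2 - d) = 1. *)
  apply: le_trans (_ : 1 + eta ((n + 2) ^+ 2 - 4 * 1) <= _); last first.
    by have := eta_le1 ((n + 2) ^+ 2 - 4 * 1); rewrite ler_norml; lia.
  rewrite -card_quad_roots lez_nat; apply: subset_leq_card.
  apply/fintype.subsetP => d; rewrite !inE => /andP[d0 /eqP <-].
  by apply/eqP; field.
have : \sum_(d : F | d != 0) (2 : int) <= 2 * q.
  by rewrite sumr_const cardC1 -[leLHS]mulr_natr ler_pM2l // natz lez_nat leq_pred.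
have q2 : q <= q ^+ 2 by rewrite expr2 ler_peMl.
move=> s2; apply: le_trans (lerD (bnd 0) (le_trans le2 (lerD s2 (ler_wpM2l _ le3)))) _ => //.
by move: q2; set Q := _ ^+ 2; lia.
Qed.

End QuadraticCharacter.

(** * Character sums *)

Section ComplexNorm.
Variable R : rcfType.
Implicit Types (z w : R[i]) (x : R).

(** The modulus as an element of [R]: the norm of [R[i]] takes its values in [R[i]], away from real
    order reasoning. *)
Definition nm z : R := Normc.normc z.

Lemma nmE z : (nm z)%:C%C = `|z|. Proof. by rewrite normc_def; case: z. Qed.

Lemma nm_ge0 z : 0 <= nm z. Proof. by rewrite -ler0c nmE. Qed.

Lemma nmM z w : nm (z * w) = nm z * nm w. Proof. exact: Normc.normcM. Qed.

Lemma nmD z w : nm (z + w) <= nm z + nm w. Proof. exact: le_normcD. Qed.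

Lemma nmN z : nm (- z) = nm z. Proof. exact: normcN. Qed.

Lemma nm0 : nm 0 = 0. Proof. exact: Normc.normc0. Qed.

Lemma nm1 : nm 1 = 1. Proof. exact: Normc.normc1. Qed.

Lemma nmJ z : nm (conjc z) = nm z.
Proof. by apply: (@complexI R); rewrite !nmE normcJ. Qed.

Lemma nm_real x : nm x%:C%C = `|x|.
Proof. by apply: (@complexI R); rewrite nmE normc_def /= expr0n addr0 sqrtr_sqr. Qed.

Lemma nm_int (n : int) : nm n%:~R = `|n%:~R|.
Proof. by rewrite -nm_real; congr nm; rewrite rmorph_int. Qed.

Lemma nm_nat (n : nat) : nm n%:R = n%:R.
Proof. by rewrite -[LHS]/(nm n%:Z%:~R) nm_int normr_nat. Qed.

Lemma nm_sqr z : (nm z ^+ 2)%:C%C = z * conjc z.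
Proof. by rewrite rmorphXn /= nmE sqr_normc. Qed.

Lemma nm_sum (I : finType) (P : pred I) (f : I -> R[i]) :
  nm (\sum_(i | P i) f i) <= \sum_(i | P i) nm (f i).
Proof.
elim/big_ind2: _ => [|z x w y zx wy|//]; first by rewrite nm0.
by apply: le_trans (nmD _ _) _; apply: lerD.
Qed.

Lemma nm_sum_le (I : finType) (P : pred I) (f : I -> R[i]) (c : R) :
  (forall i, P i -> nm (f i) <= c) -> nm (\sum_(i | P i) f i) <= #|P|%:R * c.
Proof.
move=> fc; apply: le_trans (nm_sum _ _) _.
rewrite mulr_natl -sumr_const; exact: ler_sum.
Qed.

Lemma sum_nm_sqr (I : finType) (P : pred I) (f : I -> R[i]) :
  \sum_(i | P i) nm (f i) ^+ 2 = nm (\sum_(i | P i) f i * conjc (f i)).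
Proof.
rewrite -(eq_bigr _ (fun i _ => nm_sqr (f i))) -rmorph_sum nm_real ger0_norm //.
by apply: sumr_ge0 => i _; rewrite exprn_even_ge0.
Qed.

(** Cauchy-Schwarz against the constant 1, from the expansion of the sum of all (x_i - x_j)^2. *)
Lemma sqr_sum_le (I : finType) (P : pred I) (x : I -> R) :
  (\sum_(i | P i) x i) ^+ 2 <= #|P|%:R * \sum_(i | P i) x i ^+ 2.
Proof.
have : 0 <= \sum_(i | P i) \sum_(j | P j) (x i - x j) ^+ 2.
  by apply: sumr_ge0 => i _; apply: sumr_ge0 => j _; rewrite sqr_ge0.
suff -> : \sum_(i | P i) \sum_(j | P j) (x i - x j) ^+ 2 =
    #|P|%:R * (\sum_(i | P i) x i ^+ 2) * 2 - (\sum_(i | P i) x i) ^+ 2 * 2 by lra.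
rewrite expr2 big_distrlr /= mulr_sumr !mulr_suml -sumrB.
transitivity (\sum_(i | P i) (#|P|%:R * x i ^+ 2
   + \sum_(j | P j) x j ^+ 2 - (\sum_(j | P j) x i * x j) * 2)).
  apply: eq_bigr => i _; rewrite mulr_natl -sumr_const mulr_suml -big_split -sumrB /=.
  by apply: eq_bigr => j _; ring.
rewrite !sumrB big_split /= sumr_const -!mulr_suml -mulr_sumr -[X in _ + X - _ = _]mulr_natl.
congr (_ - _); ring.
Qed.

End ComplexNorm.

(** * Bilinear forms twisted by the quadratic character *)

Section BilinearForm.
Variables (F : finFieldType) (R : rcfType).
Hypothesis two_neq0 : (2 : F) != 0.
Variable delta : R.
Hypotheses (delta_gt0 : 0 < delta) (delta_le1 : delta <= 1).
Local Notation q := (#|F|%:R : R).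
Hypothesis large : 7 <= delta ^+ 4 * q.
Implicit Types (u m r d z rho : F).

Lemma q_ge1 : 1 <= q. Proof. by rewrite ler1n card_field_gt0. Qed.

Lemma delta_q_ge7 : 7 <= delta * q.
Proof.
apply: le_trans large _; rewrite ler_wpM2r ?ler0n // -[leRHS]expr1.
by rewrite ler_wiXn2l // ltW.
Qed.

(** After the first Cauchy-Schwarz, u and rho u share the same m; dividing m + u m + u and m + rho u
    m + rho u by m gives 1 + z and 1 + rho z with z = u + u / m. *)
Definition pair_eta rho z := eta ((1 + z) * (1 + rho * z)).

Definition pair_corr rho d := \sum_z pair_eta rho z * pair_eta rho (z + d).

(** The affine map sending 0 and 1 to the roots -1 and - rho^-1 carries the quadratic to rho e^2 z
    (z - 1); the factor [eta rho] occurs twice and cancels. *)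
Lemma pair_corrE rho d : rho != 0 -> rho != 1 ->
  pair_corr rho d = etaJ (d / (1 - rho^-1)).
Proof.
move=> rho0 rho1; set e := 1 - rho^-1.
have e0 : e != 0 by rewrite subr_eq0 eq_sym invr_eq1.
rewrite /pair_corr (reindex_inj (addrI (-1))) (reindex_inj (mulfI e0)) /=.
have pE z : pair_eta rho (-1 + e * z) = eta rho * eta (z * (z - 1)).
  rewrite /pair_eta -(etaM two_neq0). rewrite -(eta_mul_sqr (rho * (z * (z - 1))) e0); congr eta.
  by rewrite /e; field.
apply: eq_bigr => z _.
have -> : -1 + e * z + d = -1 + e * (z + d / e) by rewrite mulrDr mulrCA divff // mulr1 addrA.
by rewrite !pE mulrACA eta_sq1 // mul1r -etaM.
Qed.

Lemma sum_pair_corr_sqr rho : rho != 0 -> rho != 1 ->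
  \sum_d pair_corr rho d ^+ 2 <= 7 * #|F|%:Z ^+ 2.
Proof.
move=> rho0 rho1; set e := 1 - rho^-1.
have e0 : e != 0 by rewrite subr_eq0 eq_sym invr_eq1.
apply: le_trans (sum_etaJ_sqr two_neq0).
rewrite [leRHS](reindex_inj (mulIf (invr_neq0 e0))) /=.
by apply: ler_sum => d _; rewrite pair_corrE.
Qed.

Definition corr_sum (g : F -> int) (kappa : F -> R[i]) u :=
  \sum_r (g (u + r))%:~R * kappa r.

(** Expanding the square over pairs r, r + d leaves only the autocorrelation of [g]; about [kappa]
    nothing but the bound on its modulus is used. This is how the arbitrary factor [K]
    disappears. *)
Lemma sum_corr_sum_sqr (g : F -> int) (kappa : F -> R[i]) :
  (forall r, nm (kappa r) <= 1) ->
  \sum_u nm (corr_sum g kappa u) ^+ 2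
    <= q * \sum_d `|(\sum_z g z * g (z + d))%:~R|.
Proof.
move=> k1; rewrite sum_nm_sqr.
have -> : \sum_u corr_sum g kappa u * conjc (corr_sum g kappa u) =
   \sum_r \sum_d kappa r * conjc (kappa (r + d)) * (\sum_z g z * g (z + d))%:~R.
  transitivity (\sum_u \sum_r \sum_d (g (u + r))%:~R * kappa r *
     ((g (u + (r + d)))%:~R * conjc (kappa (r + d)))).
    apply: eq_bigr => u _; rewrite /corr_sum rmorph_sum big_distrlr /=.
    apply: eq_bigr => r _; rewrite [LHS](reindex_inj (addrI r)) /=.
    by apply: eq_bigr => d _; rewrite rmorphM /= rmorph_int.
  rewrite exchange_big; apply: eq_bigr => r _; rewrite exchange_big.
  apply: eq_bigr => d _ /=; rewrite rmorph_sum mulr_sumr.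
  rewrite [RHS](reindex_inj (addIr r)) /=; apply: eq_bigr => z _.
  by rewrite rmorphM addrA /=; ring.
apply: nm_sum_le => r _; apply: le_trans (nm_sum _ _) _; apply: ler_sum => d _.
rewrite !nmM nmJ nm_int ler_piMl //.
by rewrite mulr_ile1 ?nm_ge0 // nmJ.
Qed.

(** In the notation of the proof, X^2 <= q^2 A and A^2 <= 7 q^3 give X^4 <= 7 q^7, which is where
    [7 <= delta ^+ 4 * q] comes from. *)
Lemma sum_corr_sum_le rho (kappa : F -> R[i]) : rho != 0 -> rho != 1 ->
  (forall r, nm (kappa r) <= 1) ->
  \sum_u nm (corr_sum (pair_eta rho) kappa u) <= delta * q ^+ 2.
Proof.
move=> rho0 rho1 k1; set X := \sum_u _; set A := \sum_d `|(pair_corr rho d)%:~R| : R.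
have X0 : 0 <= X by apply: sumr_ge0 => u _; apply: nm_ge0.
have q1 := q_ge1; have q0 : 0 < q by apply: lt_le_trans q1.
have XA : X ^+ 2 <= q ^+ 2 * A.
  apply: le_trans (sqr_sum_le _ _) _; rewrite cardT -cardE expr2 -mulrA.
  by rewrite ler_pM2l // sum_corr_sum_sqr.
have A2 : A ^+ 2 <= 7 * q ^+ 3.
  apply: le_trans (sqr_sum_le _ _) _; rewrite cardT -cardE.
  rewrite exprS mulrCA ler_pM2l //.
  have := sum_pair_corr_sqr rho0 rho1; rewrite -(ler_int R) rmorph_sum /=.
  rewrite rmorphM rmorphXn /=; apply: le_trans; apply: ler_sum => d _.
  by rewrite rmorphXn /= real_normK ?num_real.
have : X ^+ 4 <= (delta * q ^+ 2) ^+ 4.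
  have -> : X ^+ 4 = (X ^+ 2) ^+ 2 by rewrite -exprM.
  apply: le_trans (_ : (q ^+ 2 * A) ^+ 2 <= _).
    by rewrite lerXn2r ?nnegrE ?sqr_ge0 // mulr_ge0 ?sqr_ge0 // sumr_ge0.
  rewrite exprMn -exprM; apply: le_trans (_ : q ^+ 4 * (7 * q ^+ 3) <= _).
    by rewrite ler_wpM2l // exprn_ge0 // ltW.
  have -> : (delta * q ^+ 2) ^+ 4 = q ^+ 4 * (delta ^+ 4 * q * q ^+ 3) by ring.
  by apply: ler_wpM2l; rewrite ?exprn_ge0 ?ler0n //; apply: ler_wpM2r; rewrite ?exprn_ge0 ?ler0n.
by rewrite ler_pXn2r ?nnegrE // mulr_ge0 ?sqr_ge0 // ltW.
Qed.

Section Bilinear.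
Variables al be K : F -> R[i].
Hypotheses (al1 : forall u, nm (al u) <= 1) (be1 : forall u, nm (be u) <= 1)
  (K1 : forall u, nm (K u) <= 1).

Definition row_sum m :=
  \sum_(u | u != 0) (eta (- (m + u * m + u)))%:~R * al u * K (u / m).

Definition bilinear := \sum_(m | m != 0) be m * row_sum m.

(** The ratio r = u / m is never 0; the value 0 at [r = 0] lets [corr_sum] run over the whole
    field. *)
Definition twist rho r := if r == 0 then 0 else K r * conjc (K (rho * r)).

Lemma twist_le1 rho r : nm (twist rho r) <= 1.
Proof.
rewrite /twist; case: eqP => _; first by rewrite nm0.
by rewrite nmM nmJ mulr_ile1 ?nm_ge0.
Qed.

(* Substitute rho = u' / u and r = u / m in the double sum over u and u'. *)
Lemma row_sum_sqr :
  \sum_(m | m != 0) row_sum m * conjc (row_sum m) =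
  \sum_(rho | rho != 0) \sum_(u | u != 0)
     al u * conjc (al (rho * u)) * corr_sum (pair_eta rho) (twist rho) u.
Proof.
transitivity (\sum_(m | m != 0) \sum_(u | u != 0) \sum_(rho | rho != 0)
  al u * conjc (al (rho * u)) *
    ((pair_eta rho (u + u / m))%:~R * twist rho (u / m))).
  apply: eq_bigr => m m0; rewrite /row_sum rmorph_sum big_distrlr /=.
  apply: eq_bigr => u u0; rewrite [LHS](reindex_inj (mulIf u0)) /=.
  apply: eq_big => [r|r r0]; first by rewrite mulf_eq0 (negPf u0) orbF.
  rewrite !rmorphM rmorph_int /= /twist mulf_eq0 invr_eq0 (negPf u0) (negPf m0) /=.
  rewrite (mulrA r u).
  suff -> : pair_eta r (u + u / m) = eta (- (m + u * m + u)) *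
      eta (- (m + r * u * m + r * u)) by rewrite rmorphM /=; ring.
  rewrite -(etaM two_neq0) -[RHS](eta_mul_sqr _ (invr_neq0 m0)); congr eta.
  by field.
transitivity (\sum_(u | u != 0) \sum_(m | m != 0) \sum_(rho | rho != 0)
  al u * conjc (al (rho * u)) *
    ((pair_eta rho (u + m))%:~R * twist rho m)).
  rewrite exchange_big; apply: eq_bigr => u u0 /=.
  rewrite (reindex_inj invr_inj) (reindex_inj (mulIf (invr_neq0 u0))) /=.
  apply: eq_big => [m|m _].
    by rewrite invr_eq0 mulf_eq0 invr_eq0 (negPf u0) orbF.
  by apply: eq_bigr => rho _; rewrite invrK (mulrC u) divfK.
rewrite [RHS]exchange_big; apply: eq_bigr => u u0 /=.
rewrite exchange_big; apply: eq_bigr => rho _ /=.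
rewrite -mulr_sumr; congr (_ * _); rewrite /corr_sum [RHS](bigD1 0) //=.
by rewrite {2}/twist eqxx mulr0 add0r.
Qed.

(** Cauchy-Schwarz over m removes [be], and the triangle inequality over rho and u removes [al]. At
    rho = 1 the argument of [pair_eta] is a square and only the trivial bound q^2 is available; the
    at most q other values of rho contribute [delta * q ^+ 2] each, which dominates since delta q >=
    1. *)
Lemma bilinear_le : nm bilinear ^+ 2 <= 2 * delta * q ^+ 4.
Proof.
have q1 := q_ge1; have q0 : 0 < q by apply: lt_le_trans q1.
apply: le_trans (_ : (\sum_(m | m != 0) nm (row_sum m)) ^+ 2 <= _).
  rewrite lerXn2r ?nnegrE ?nm_ge0 //; first by apply: sumr_ge0 => m _; apply: nm_ge0.
  apply: le_trans (nm_sum _ _) _; apply: ler_sum => m _.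
  by rewrite nmM ler_piMl ?nm_ge0.
apply: le_trans (sqr_sum_le _ _) _; rewrite sum_nm_sqr row_sum_sqr.
apply: le_trans (_ : q * (2 * delta * q ^+ 3) <= _); last first.
  by rewrite le_eqVlt; apply/orP; left; apply/eqP; ring.
apply: ler_pM; rewrite ?nm_ge0 ?ler0n //; first by rewrite ler_nat max_card.
apply: le_trans (nm_sum _ _) _.
have step rho : nm (\sum_(u | u != 0) al u * conjc (al (rho * u)) *
     corr_sum (pair_eta rho) (twist rho) u)
    <= \sum_u nm (corr_sum (pair_eta rho) (twist rho) u).
  apply: le_trans (nm_sum _ _) _; rewrite big_mkcond /=; apply: ler_sum => u _.
  case: ifP => _; last exact: nm_ge0.
  by rewrite 2!nmM nmJ ler_piMl ?nm_ge0 // mulr_ile1 ?nm_ge0.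
rewrite (bigD1 1) ?oner_eq0 //=.
apply: le_trans (_ : q ^+ 2 + q * (delta * q ^+ 2) <= _).
  apply: lerD.
    apply: le_trans (step 1) _; apply: le_trans (_ : \sum_(u : F) q <= _).
      apply: ler_sum => u _; rewrite -[leRHS]mulr1; apply: nm_sum_le => r _.
      rewrite nmM mulr_ile1 ?nm_ge0 ?twist_le1 // nm_int -intr_norm.
      by rewrite -[leRHS](mulr1z 1) ler_int eta_le1.
    by rewrite sumr_const -[leLHS]mulr_natl expr2.
  apply: le_trans (_ : \sum_(rho : F | (rho != 0) && (rho != 1)) delta * q ^+ 2 <= _).
    apply: ler_sum => rho /andP[r0 r1]; apply: le_trans (step rho) _.
    by apply: sum_corr_sum_le => // r; apply: twist_le1.
  rewrite sumr_const -[leLHS]mulr_natl ler_wpM2r ?ler_nat ?max_card //.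
  by rewrite mulr_ge0 ?sqr_ge0 // ltW.
have -> : 2 * delta * q ^+ 3 = q ^+ 2 * (delta * q) + q * (delta * q ^+ 2) by ring.
by rewrite lerD2r ler_peMr ?sqr_ge0 //; apply: le_trans delta_q_ge7; lra.
Qed.

End Bilinear.
End BilinearForm.

(** * Kloosterman sums and the sum with poles at 0, 1 and infinity *)

Section CharacterSum.
Variables (F : finFieldType) (R : rcfType).
Hypothesis two_neq0 : (2 : F) != 0.
Variable psi : F -> R[i].
Hypotheses (psiD : forall x y, psi (x + y) = psi x * psi y)
  (nm_psi : forall x, nm (psi x) = 1) (sum_psi : \sum_x psi x = 0).
Local Notation q := (#|F|%:R : R).
Implicit Types (a b c s v x y z m u : F).

Lemma psi0 : psi 0 = 1.
Proof.
have p0 : psi 0 != 0.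
  by apply/eqP => p0; have := nm_psi 0; rewrite p0 nm0 => /eqP; rewrite eq_sym oner_eq0.
by apply: (mulfI p0); rewrite -psiD addr0 mulr1.
Qed.

Lemma psi_conj x : conjc (psi x) = psi (- x).
Proof.
have e : psi x * conjc (psi x) = 1 by rewrite -nm_sqr nm_psi expr1n.
have p0 : psi x != 0 by apply: contra_eq_neq e => ->; rewrite mul0r eq_sym oner_eq0.
by apply: (mulfI p0); rewrite e -psiD subrr psi0.
Qed.

Lemma sum_psi_mul z : \sum_m psi (m * z) = (z == 0)%:R * #|F|%:R.
Proof.
case: eqVneq => [->|z0]; last by rewrite mul0r -[RHS]sum_psi [RHS](reindex_inj (mulIf z0)).
rewrite (eq_bigr (fun=> 1)) => [|m _]; last by rewrite mulr0 psi0.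
by rewrite sumr_const mul1r.
Qed.

Definition kloosterman m := \sum_(y | y != 0) psi (m * y + y^-1).

Lemma kloosterman0 : kloosterman 0 = -1.
Proof.
rewrite /kloosterman (reindex_inj invr_inj) /=.
rewrite (eq_big (fun y => y != 0) psi) => [|y|y _].
- by have := sum_psi; rewrite (bigD1 0) //= psi0 addrC => /eqP; rewrite addr_eq0 => /eqP.
- by rewrite invr_eq0.
- by rewrite mul0r add0r invrK.
Qed.

Lemma sum_kloosterman_sqr : \sum_m nm (kloosterman m) ^+ 2 <= q ^+ 2.
Proof.
rewrite sum_nm_sqr.
have -> : \sum_m kloosterman m * conjc (kloosterman m) =
    \sum_(y : F | y != 0) #|F|%:R.
  transitivity (\sum_m \sum_(y | y != 0) \sum_(z | z != 0)
      psi (y^-1 - z^-1) * psi (m * (y - z))).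
    apply: eq_bigr => m _; rewrite /kloosterman rmorph_sum big_distrlr /=.
    apply: eq_bigr => y _; apply: eq_bigr => z _.
    by rewrite psi_conj -!psiD; congr psi; ring.
  rewrite exchange_big; apply: eq_bigr => y y0; rewrite exchange_big /=.
  under eq_bigr => z _ do rewrite -mulr_sumr sum_psi_mul subr_eq0.
  rewrite (bigD1 y) //= eqxx subrr psi0 !mul1r big1 ?addr0 // => z /andP[_ zy].
  by rewrite eq_sym (negPf zy) mul0r mulr0.
rewrite expr2; apply: le_trans (_ : #|[pred y : F | y != 0]|%:R * q <= _).
  by apply: nm_sum_le => y _; rewrite nm_nat.
by rewrite ler_wpM2r ?ler0n // ler_nat max_card.
Qed.

Definition two_pole_sum a b d :=
  \sum_(v | (v != 0) && (v != d)) psi (a / v + b / (v - d)).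

Lemma two_pole_sumC a b d : two_pole_sum a b d = two_pole_sum (- b) (- a) d.
Proof.
have dv v : (d - v == d) = (v == 0) by rewrite -subr_eq0 addrAC subrr add0r oppr_eq0.
rewrite /two_pole_sum (reindex_inj (subrI d)) /=.
apply: eq_big => [v|v]; rewrite dv subr_eq0 (eq_sym d) 1?andbC // => /andP[v0 vd].
congr psi; have vd' : v - d != 0 by rewrite subr_eq0.
have dv' : d - v != 0 by rewrite subr_eq0 eq_sym.
by field; rewrite vd' v0 dv' addrAC subrr add0r oppr_eq0 v0.
Qed.

(** The substitution v = d / (1 - (b / d) y) puts the pole v = d at y = 0 and the pole v = 0 at
    infinity, so the two fractions become a linear term and y^-1, up to a constant. The extra 1 is
    the term y = d / b of the Kloosterman sum, which would be v at infinity. *)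
Lemma two_pole_sum_le a b d : d != 0 -> (a != 0) || (b != 0) ->
  nm (two_pole_sum a b d) <= 1 + nm (kloosterman (- (a * b) / d ^+ 2)).
Proof.
move=> d0; wlog b0 : a b / b != 0.
  move=> H /orP[a0|b0]; last by apply: H => //; rewrite b0 orbT.
  rewrite two_pole_sumC; have -> : a * b = - b * - a by ring.
  by apply: H; rewrite !oppr_eq0 a0 ?orbT.
move=> _; have bd0 : b / d != 0 by rewrite mulf_neq0 ?invr_eq0.
have inj : injective (fun y => d * (1 - b / d * y)^-1).
  by move=> x y /(mulfI d0)/invr_inj/addrI/oppr_inj/(mulfI bd0).
have -> : two_pole_sum a b d = psi ((a - b) / d) *
    (kloosterman (- (a * b) / d ^+ 2) - psi (- a / d + b / d)).
  rewrite mulrBr /kloosterman mulr_sumr (bigD1 (d / b)) /=; last first.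
    by rewrite mulf_neq0 ?invr_eq0.
  set X := psi _ * psi _; have -> : X = psi ((a - b) / d) * psi (- a / d + b / d).
    by congr (_ * psi _); field; rewrite d0 b0.
  rewrite addrAC subrr add0r /two_pole_sum (reindex_inj inj) /=.
  have eqd y : (y != d / b) = (1 - b / d * y != 0).
    rewrite subr_eq0 [in RHS]eq_sym; congr negb; apply/eqP/eqP => [->|e]; first by field; rewrite ?d0 b0.
    by apply: (mulfI bd0); rewrite e; field; rewrite ?d0 b0.
  have dd y : (d * (1 - b / d * y)^-1 == d) = (y == 0).
    rewrite -[X in _ == X]mulr1 (inj_eq (mulfI d0)) -[X in _ == X]invr1 (inj_eq invr_inj).
    by rewrite -subr_eq0 addrAC subrr add0r oppr_eq0 mulf_eq0 (negPf bd0).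
  apply: eq_big => [y|y].
    by rewrite mulf_eq0 (negPf d0) invr_eq0 /= eqd dd andbC.
  rewrite mulf_eq0 (negPf d0) invr_eq0 /= dd => /andP[w0 y0].
  rewrite -psiD; congr psi; set w := 1 - _ in w0 *.
  have e : d - d * w = b * y by rewrite /w; field.
  clearbody w; have -> : d / w - d = b * y / w by rewrite -e; field.
  have yE : y = (1 - w) * d / b by apply: (mulfI b0); rewrite -e; field.
  have w1 : 1 - w != 0 by apply: contraNneq y0 => w1; rewrite yE w1 !mul0r.
  by rewrite yE; field; rewrite b0 d0 w0 w1.
by rewrite nmM nm_psi mul1r addrC; apply: le_trans (nmD _ _) _; rewrite nmN nm_psi.
Qed.

Lemma card_two_pole_param a b n : a * b != 0 ->
  (#|[pred s | s != 1%R & - (a * s * (b * (s - 2))) / (s - 1) ^+ 2 == n]| <= 2)%N.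
Proof.
rewrite mulf_eq0 negb_or => /andP[a0 b0]; set z := 1 + n / (a * b).
have inj : injective (fun s => (s - 1)^-1) by move=> x y /invr_inj/addIr.
apply: (@leq_trans #|[pred s | (s - 1)^-1 ^+ 2 == z]|).
  apply: subset_leq_card; apply/fintype.subsetP => s; rewrite !inE => /andP[s1 /eqP e].
  have s10 : s - 1 != 0 by rewrite subr_eq0.
  by apply/eqP; rewrite /z -e; field; rewrite s10 a0 b0.
have -> : #|[pred s | (s - 1)^-1 ^+ 2 == z]| = #|[pred y | y ^+ 2 == z]|.
  rewrite -[RHS](on_card_preimset (f := fun s => (s - 1)^-1)) /=.
    by apply: fintype.eq_card => x; rewrite !inE.
  by apply: onW_bij; apply: (injF_bij inj).
rewrite -lez_nat card_sqrt //.
by have := eta_le1 z; rewrite ler_norml => /andP[_]; rewrite -(lerD2l 1).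
Qed.

Definition main_sum a b c :=
  \sum_s psi (c * s) * two_pole_sum (a * s) (b * (s - 2)) (s - 1).

(* Every inner sum is a Kloosterman sum up to one term, and its parameter
   - a b (1 - (s - 1)^-2) takes each value at most twice. *)
Lemma main_sum_le a b c : (a != 0) || (b != 0) ->
  nm (main_sum a b c) ^+ 2 <= 9 * q ^+ 3.
Proof.
move=> ab; pose T s := two_pole_sum (a * s) (b * (s - 2)) (s - 1).
pose k s := kloosterman (- (a * s * (b * (s - 2))) / (s - 1) ^+ 2).
have q1 : 1 <= q := q_ge1 F R.
have triv s : nm (T s) ^+ 2 <= q ^+ 2.
  rewrite lerXn2r ?nnegrE ?nm_ge0 ?ler0n // -[leRHS]mulr1.
  apply: le_trans (nm_sum_le (c := 1) _) _ => [v _|]; first by rewrite nm_psi.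
  by rewrite !mulr1 ler_nat max_card.
have good s : s != 0 -> s != 1 -> s != 2 -> nm (T s) ^+ 2 <= 2 + 2 * nm (k s) ^+ 2.
  move=> s0 s1 s2; have : nm (T s) <= 1 + nm (k s).
    apply: two_pole_sum_le; rewrite ?subr_eq0 // !mulf_eq0 !negb_or s0 andbT.
    by rewrite subr_eq0 s2 andbT.
  have := nm_ge0 (T s); have := nm_ge0 (k s); set x := nm (k s); set y := nm (T s).
  move=> x0 y0 yx; have := sqr_ge0 (1 - x).
  have : 0 <= (1 + x - y) * (1 + x + y) by apply: mulr_ge0; lra.
  lra.
have sumk : \sum_(s | s != 1) nm (k s) ^+ 2 <= 2 * q ^+ 2.
  have [ab0|ab0] := eqVneq (a * b) 0.
    apply: le_trans (_ : \sum_(s : F | s != 1) 1 <= _).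
      apply: ler_sum => s _; rewrite /k.
      have -> : a * s * (b * (s - 2)) = a * b * (s * (s - 2)) by ring.
      by rewrite ab0 mul0r oppr0 mul0r kloosterman0 nmN nm1 expr1n.
    rewrite sumr_const; apply: le_trans (_ : q <= _); first by rewrite ler_nat max_card.
    by nra.
  apply: le_trans (_ : 2 * \sum_m nm (kloosterman m) ^+ 2 <= _).
    apply: (sum_two_to_one (phi := fun s => - (a * s * (b * (s - 2))) / (s - 1) ^+ 2)
      (g := fun m => nm (kloosterman m) ^+ 2)) => n; first by rewrite sqr_ge0.
    exact: card_two_pole_param.
  by rewrite ler_pM2l // sum_kloosterman_sqr.
(* The constant 9: at s = 0, 1 and 2, where a coefficient or the distance of the poles vanishes, the
   trivial bound q^2 is used; the rest gives 2 q + 2 (2 q^2). *)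
have sumT : \sum_s nm (T s) ^+ 2 <= 9 * q ^+ 2.
  apply: le_trans (_ : \sum_s ((s == 0)%:R * q ^+ 2 + (s == 1)%:R * q ^+ 2
     + (s == 2)%:R * q ^+ 2 + (2 + (if s != 1 then 2 * nm (k s) ^+ 2 else 0))) <= _).
    apply: ler_sum => s _; have := triv s; have := sqr_ge0 (nm (k s)).
    have := sqr_ge0 q.
    case: (eqVneq s 0) => [_|s0]; case: (eqVneq s 1) => [_|s1] /=;
      case: (eqVneq s 2) => [_|s2]; rewrite /= ?mul0r ?mul1r; try lra.
    by have := good s s0 s1 s2; lra.
  have one x : \sum_s (s == x)%:R * q ^+ 2 = q ^+ 2.
    rewrite (bigD1 x) //= eqxx mul1r big1 ?addr0 // => s /negPf->.
    by rewrite mul0r.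
  rewrite !big_split /= !one sumr_const -big_mkcond -mulr_sumr /=.
  apply: le_trans (_ : q ^+ 2 + q ^+ 2 + q ^+ 2 + (q + q + 2 * (2 * q ^+ 2)) <= _).
    by rewrite lerD2l; apply: lerD; [apply: lerD; rewrite ler_nat max_card|rewrite ler_pM2l].
  have : q <= q ^+ 2 by rewrite expr2 ler_peMl.
  by lra.
apply: le_trans (_ : (\sum_s nm (T s)) ^+ 2 <= _).
  rewrite lerXn2r ?nnegrE ?nm_ge0 //; first by apply: sumr_ge0 => s _; apply: nm_ge0.
  apply: le_trans (nm_sum _ _) _; apply: ler_sum => s _.
  by rewrite nmM nm_psi mul1r.
apply: le_trans (sqr_sum_le _ _) _; rewrite cardT -cardE exprS mulrCA.
by rewrite ler_wpM2l ?ler0n.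
Qed.

Definition charsum a b c :=
  \sum_(x | (x != 0) && (x != 1)) psi (a / x + b / (x - 1) + c * x).

(** For s = x + y and v = x y one has 1/x + 1/y = s / v and 1/(x - 1) + 1/(y - 1) = (s - 2) / (v -
    (s - 1)), so this is the product of the summands of [charsum] at x and at y. *)
Definition phase a b c s v := psi (c * s + (a * s / v + b * (s - 2) / (v - (s - 1)))).

(* Extended by 0 to the poles of [phase], so that the sums over v are complete. *)
Definition eta_term a b c s v : R[i] :=
  if (v != 0) && (v != s - 1) then (eta (s ^+ 2 - 4 * v))%:~R * phase a b c s v else 0.

(* Group the pairs (x, y) of the square by s = x + y and v = x y. *)
Lemma charsum_sqr a b c :
  charsum a b c ^+ 2 = main_sum a b c + \sum_s \sum_v eta_term a b c s v.
Proof.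
pose f x := if (x != 0) && (x != 1) then psi (a / x + b / (x - 1) + c * x) else 0.
pose G s v := if (v != 0) && (v != s - 1) then phase a b c s v else 0.
transitivity (\sum_s \sum_x G s (x * (s - x))).
  rewrite /charsum big_mkcond /= -/f expr2 big_distrlr /= exchange_big /=.
  transitivity (\sum_x \sum_s f x * f (s - x)).
    rewrite exchange_big; apply: eq_bigr => x _ /=.
    by rewrite [LHS](reindex_inj (addIr (- x))).
  rewrite exchange_big; apply: eq_bigr => s _; apply: eq_bigr => x _ /=.
  have e : x * (s - x) - (s - 1) = (x - 1) * (s - x - 1) by ring.
  rewrite /f /G /phase e mulf_eq0 -(subr_eq0 (x * _)) e mulf_eq0 !negb_or.
  rewrite -!(subr_eq0 _ 1).
  case: (eqVneq x 0) => x0; rewrite /= ?mul0r //.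
  case: (eqVneq (x - 1) 0) => x1; rewrite /= ?andbF ?mul0r //.
  case: (eqVneq (s - x) 0) => s0; rewrite /= ?mulr0 //.
  case: (eqVneq (s - x - 1) 0) => s1; rewrite /= ?mulr0 //.
  by rewrite -psiD; congr psi; field; rewrite x0 x1 s0 s1.
rewrite /main_sum -big_split /=; apply: eq_bigr => s _.
rewrite (sum_quad two_neq0 (G s)) /two_pole_sum mulr_sumr [X in _ = X + _]big_mkcond.
rewrite -big_split /=; apply: eq_bigr => v _; rewrite /G /eta_term.
case: ifP => _; last by rewrite mul0rz addr0.
by rewrite mulrzDr mulr1z mulrzl /phase -psiD.
Qed.

Lemma eta_term_le a b c s v : nm (eta_term a b c s v) <= 1.
Proof.
rewrite /eta_term; case: ifP => _; last by rewrite nm0.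
rewrite nmM nm_psi mulr1 nm_int -intr_norm -[leRHS](mulr1z 1) ler_int.
exact: eta_le1.
Qed.

Definition shifted e m := if 1 + m == 0 then 0 else psi (e / (1 + m)).

Lemma shifted_le1 e m : nm (shifted e m) <= 1.
Proof. by rewrite /shifted; case: ifP; rewrite ?nm0 ?nm_psi. Qed.

(** The substitution separates the phase: c s depends on u alone, a s / v = 2 a / (1 + m) on m
    alone, and the b term, - 2 b + 2 b / (1 + u / m), on the ratio. The discriminant s^2 - 4 v is -
    (m + u m + u) times a square. *)
Lemma eta_term_shift a b c u m : 1 + u != 0 -> m != 0 ->
  eta_term a b c (2 / (1 + u)) ((1 + m) / (1 + u)) =
  shifted (2 * a) m * ((eta (- (m + u * m + u)))%:~R * (shifted (2 * c) u * psi (- (2 * b)))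
    * shifted (2 * b) (u / m)).
Proof.
move=> u1 m0; rewrite /eta_term /phase /shifted (negPf u1).
rewrite mulf_eq0 invr_eq0 (negPf u1) orbF.
have -> : (1 + m) / (1 + u) == 2 / (1 + u) - 1 = (m + u == 0).
  rewrite -subr_eq0; have -> : (1 + m) / (1 + u) - (2 / (1 + u) - 1) = (m + u) / (1 + u) by field.
  by rewrite mulf_eq0 invr_eq0 (negPf u1) orbF.
have -> : 1 + u / m == 0 = (m + u == 0).
  have -> : 1 + u / m = (m + u) / m by field.
  by rewrite mulf_eq0 invr_eq0 (negPf m0) orbF.
case: (eqVneq (1 + m) 0) => m1 /=; first by rewrite mul0r.
case: (eqVneq (m + u) 0) => mu /=; first by rewrite !mulr0.
have -> : eta ((2 / (1 + u)) ^+ 2 - 4 * ((1 + m) / (1 + u))) = eta (- (m + u * m + u)).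
  have w0 : 2 / (1 + u) != 0 by rewrite mulf_neq0 ?invr_eq0.
  by rewrite -[RHS](eta_mul_sqr _ w0); congr eta; field.
have rearrange (x y z w t : R[i]) : x * (y * (z * w) * t) = y * (x * z * w * t) by ring.
rewrite rearrange -!psiD; congr (_ * psi _).
by field; rewrite m0 mu u1 m1.
Qed.

Definition eta_bilinear a b c := bilinear
  (fun u => shifted (2 * c) u * psi (- (2 * b))) (shifted (2 * a)) (shifted (2 * b)).

Lemma eta_bilinearE a b c : eta_bilinear a b c =
  \sum_(u | (1 + u != 0) && (u != 0)) \sum_(m | m != 0)
    eta_term a b c (2 / (1 + u)) ((1 + m) / (1 + u)).
Proof.
rewrite /eta_bilinear /bilinear /row_sum; under eq_bigr => m _ do rewrite mulr_sumr.
rewrite exchange_big big_mkcond [RHS]big_mkcond /=; apply: eq_bigr => u _.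
case: (eqVneq u 0) => u0; rewrite /= ?andbF ?andbT //.
case: (eqVneq (1 + u) 0) => u1 /=.
  by rewrite big1 // => m _; rewrite /shifted u1 eqxx !(mul0r, mulr0).
by apply: eq_bigr => m m0; rewrite eta_term_shift.
Qed.

(** The substitution misses the line s = 0, and the bilinear form omits u = 0 and m = 0; each of
    these three lines has at most q terms of modulus at most 1. *)
Lemma eta_sum_le a b c :
  nm (\sum_s \sum_v eta_term a b c s v) <= nm (eta_bilinear a b c) + 3 * q.
Proof.
have ub (P : pred F) (f : F -> R[i]) : (forall i, nm (f i) <= 1) -> nm (\sum_(i | P i) f i) <= q.
  move=> f1; apply: le_trans (nm_sum_le (c := 1) _) _ => [i _|]; first exact: f1.
  by rewrite mulr1 ler_nat max_card.
have inj : injective (fun u => 2 / (1 + u)) by move=> x y /(mulfI two_neq0)/invr_inj/addrI.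
have -> : \sum_s \sum_v eta_term a b c s v = eta_bilinear a b c
    + (\sum_v eta_term a b c 0 v + (\sum_m eta_term a b c 2 (1 + m)
    + \sum_(u | (1 + u != 0) && (u != 0)) eta_term a b c (2 / (1 + u)) (1 / (1 + u)))).
  rewrite (bigD1 0) //=.
  have -> : \sum_(s | s != 0) \sum_v eta_term a b c s v = \sum_(u | 1 + u != 0)
      \sum_m eta_term a b c (2 / (1 + u)) ((1 + m) / (1 + u)).
    rewrite (reindex_inj inj) /=; apply: eq_big => u.
      by rewrite mulf_eq0 (negPf two_neq0) invr_eq0.
    rewrite mulf_eq0 (negPf two_neq0) invr_eq0 /= => u1.
    by rewrite [LHS](reindex_inj (mulIf (invr_neq0 u1))) /= [LHS](reindex_inj (addrI 1)).
  have -> : \sum_(u | 1 + u != 0) \sum_m eta_term a b c (2 / (1 + u)) ((1 + m) / (1 + u))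
      = \sum_m eta_term a b c 2 (1 + m) + \sum_(u | (1 + u != 0) && (u != 0))
         \sum_m eta_term a b c (2 / (1 + u)) ((1 + m) / (1 + u)).
    rewrite (bigD1 0) /=; last by rewrite addr0 oner_eq0.
    by congr (_ + _); apply: eq_bigr => m _; rewrite addr0 !divr1.
  have -> : \sum_(u | (1 + u != 0) && (u != 0))
         \sum_m eta_term a b c (2 / (1 + u)) ((1 + m) / (1 + u)) =
       \sum_(u | (1 + u != 0) && (u != 0)) eta_term a b c (2 / (1 + u)) (1 / (1 + u))
       + eta_bilinear a b c.
    rewrite eta_bilinearE -big_split; apply: eq_bigr => u _ /=.
    by rewrite (bigD1 0) //= addr0.
  by ring.
apply: le_trans (nmD _ _) _; rewrite lerD2l.
have -> : 3 * q = q + (q + q) by ring.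
apply: le_trans (nmD _ _) _; apply: lerD; first by apply: ub => v; apply: eta_term_le.
apply: le_trans (nmD _ _) _; apply: lerD; apply: ub => v; exact: eta_term_le.
Qed.

Variable delta : R.
Hypotheses (delta_gt0 : 0 < delta) (delta_le1 : delta <= 1).
Hypothesis large : 7 <= delta ^+ 4 * q.

(** If a or b is non-zero, |S|^4 = |S^2|^2 is at most 3 (M^2 + B^2 + 9 q^2), with M the main sum and
    B the bilinear form; all but B^2 is of lower order because 7 q^3 <= delta q^4, and 62 leaves
    ample room. If a = b = 0, S is a complete sum of [psi] without two terms. *)
Lemma charsum_le a b c : [|| a != 0, b != 0 | c != 0] ->
  nm (charsum a b c) ^+ 4 <= 62 * delta * q ^+ 4.
Proof.
have dq : 7 <= delta * q := delta_q_ge7 delta_gt0 delta_le1 large.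
have q1 : 1 <= q := q_ge1 F R.
have q3 : q ^+ 3 * 7 <= delta * q ^+ 4.
  have -> : delta * q ^+ 4 = q ^+ 3 * (delta * q) by ring.
  by rewrite ler_wpM2l // exprn_ge0 // ler0n.
have q23 : q ^+ 2 <= q ^+ 3 by rewrite ler_weXn2l.
have q12 : 1 <= q ^+ 2 by rewrite exprn_ege1.
case: (boolP ((a != 0) || (b != 0))) => [ab _|].
  have -> : nm (charsum a b c) ^+ 4 = nm (charsum a b c ^+ 2) ^+ 2.
    by rewrite (expr2 (charsum _ _ _)) nmM -expr2 -exprM.
  have B2 : nm (eta_bilinear a b c) ^+ 2 <= 2 * delta * q ^+ 4.
    apply: bilinear_le => // u; rewrite ?shifted_le1 //.
    by rewrite nmM nm_psi mulr1 shifted_le1.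
  have M2 := main_sum_le c ab; have E := eta_sum_le a b c.
  rewrite charsum_sqr; have := nmD (main_sum a b c) (\sum_s \sum_v eta_term a b c s v).
  have := nm_ge0 (main_sum a b c + \sum_s \sum_v eta_term a b c s v).
  have := nm_ge0 (main_sum a b c); have := nm_ge0 (eta_bilinear a b c).
  move: B2 M2 E; set B := nm (eta_bilinear _ _ _); set M := nm (main_sum _ _ _).
  set N := nm (\sum_s _); set X := nm (_ + _) => B2 M2 E B0 M0 X0 XMN.
  have X1 : X <= M + (B + 3 * q) by lra.
  have : X ^+ 2 <= (M + (B + 3 * q)) ^+ 2 by rewrite lerXn2r ?nnegrE //; lra.
  have : (M + (B + 3 * q)) ^+ 2 <= 3 * (M ^+ 2 + B ^+ 2 + 9 * q ^+ 2).
    have := sqr_ge0 (M - B); have := sqr_ge0 (M - 3 * q); have := sqr_ge0 (B - 3 * q).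
    rewrite -subr_ge0 => H1 H2 H3; lra.
  have : 2 * delta * q ^+ 4 = 2 * (delta * q ^+ 4) by ring.
  have : 62 * delta * q ^+ 4 = 62 * (delta * q ^+ 4) by ring.
  lra.
rewrite negb_or !negbK => /andP[/eqP-> /eqP->]; rewrite eqxx /= => c0.
have : nm (charsum 0 0 c) <= 2.
  have -> : charsum 0 0 c = - 1 - psi c.
    have := sum_psi_mul c; rewrite (negPf c0) mul0r (bigD1 0) //= mul0r psi0.
    rewrite (bigD1 1) ?oner_eq0 //= mul1r => e.
    rewrite /charsum (eq_bigr (fun x => psi (x * c))) => [|x _]; last first.
      by rewrite !mul0r !add0r mulrC.
    by rewrite -[RHS]addr0 -[X in _ = _ + X]e; ring.
  by apply: le_trans (nmD _ _) _; rewrite !nmN nm1 nm_psi; lra.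
have := nm_ge0 (charsum 0 0 c); set X := nm _ => X0 X2.
have : X ^+ 4 <= 2 ^+ 4 by rewrite lerXn2r ?nnegrE.
have : 62 * delta * q ^+ 4 = 62 * (delta * q ^+ 4) by ring.
lra.
Qed.

End CharacterSum.

(** * Equidistribution of the curve *)

Section BoxDiscrepancy.
Variables (F : finFieldType) (R : rcfType).
Variable psi : F -> R[i].
Hypotheses (psiD : forall x y, psi (x + y) = psi x * psi y)
  (nm_psi : forall x, nm (psi x) = 1) (sum_psi : \sum_x psi x = 0).
Local Notation q := (#|F|%:R : R).
Local Notation V := (F * F * F)%type.
Implicit Types (k v r : V).

Definition tripsi k v := psi (k.1.1 * v.1.1 + k.1.2 * v.1.2 + k.2 * v.2).

Lemma tripsiD k v r : tripsi k (v + r) = tripsi k v * tripsi k r.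
Proof. by rewrite /tripsi -psiD; congr psi => /=; ring. Qed.

Lemma nm_tripsi k v : nm (tripsi k v) = 1. Proof. exact: nm_psi. Qed.

Lemma sum_tripsi v : \sum_k tripsi k v = (v == 0)%:R * #|F|%:R ^+ 3.
Proof.
transitivity ((\sum_x psi (x * v.1.1)) * (\sum_x psi (x * v.1.2)) * \sum_x psi (x * v.2)).
  rewrite big_distrlr /= pair_bigA /= big_distrlr /= pair_bigA /=.
  by apply: eq_bigr => k _; rewrite -!psiD.
rewrite !sum_psi_mul //; case: v => -[a b] c /=.
have -> : ((a, b, c) == 0 :> V) = (a == 0) && (b == 0) && (c == 0) by [].
by case: (a == 0); case: (b == 0); case: (c == 0); rewrite /= ?mul0r ?mulr0 ?mul1r //; ring.
Qed.

Lemma parseval (f : V -> R[i]) :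
  \sum_k nm (\sum_v f v * tripsi k v) ^+ 2 = q ^+ 3 * \sum_v nm (f v) ^+ 2.
Proof.
apply: (@complexI R); rewrite rmorphM !rmorph_sum rmorphXn rmorph_nat /=.
under eq_bigr => k _ do rewrite nm_sqr.
under [in RHS]eq_bigr => v _ do rewrite nm_sqr.
transitivity (\sum_k \sum_v \sum_r f v * conjc (f r) * tripsi k (v - r)).
  apply: eq_bigr => k _; rewrite rmorph_sum big_distrlr /=.
  apply: eq_bigr => v _; apply: eq_bigr => r _.
  have -> : tripsi k (v - r) = tripsi k v * conjc (tripsi k r).
    rewrite tripsiD; congr (_ * _); rewrite /tripsi psi_conj //.
    by congr psi => /=; ring.
  by rewrite rmorphM /=; ring.
rewrite exchange_big mulr_sumr; apply: eq_bigr => v _; rewrite exchange_big /=.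
under eq_bigr => r _ do rewrite -mulr_sumr sum_tripsi subr_eq0.
rewrite (bigD1 v) //= eqxx mul1r big1 ?addr0 => [|r]; first by rewrite mulrC.
by rewrite eq_sym => /negPf->; rewrite mul0r mulr0.
Qed.

Variables (Y : finType) (gam : Y -> V) (B : {set V}).

(** The convolution of the curve with the indicator of [B], so that its Fourier transform is a
    product. *)
Definition hits r : R := \sum_y (r - gam y \in B)%:R.

Lemma sum_hits_tripsi k : \sum_r (hits r)%:C%C * tripsi k r =
  (\sum_y tripsi k (gam y)) * \sum_(b in B) tripsi k b.
Proof.
under eq_bigr => r _ do rewrite /hits rmorph_sum mulr_suml.
rewrite exchange_big mulr_suml; apply: eq_bigr => y _ /=.
rewrite mulr_sumr [RHS]big_mkcond (reindex_inj (addIr (gam y))) /=.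
apply: eq_bigr => r _; rewrite addrK rmorph_nat mulrC tripsiD.
by case: ifP => _; rewrite ?mulr0 // mulr1 mulrC.
Qed.

Lemma card_triple : #|{: V}|%:R = q ^+ 3.
Proof. by rewrite !card_prod !natrM; ring. Qed.

Lemma sum_hits : \sum_r hits r = #|Y|%:R * #|B|%:R.
Proof.
rewrite /hits exchange_big /= -[#|Y|]/(#|xpredT : pred Y|) mulr_natl -sumr_const.
apply: eq_bigr => y _; rewrite (reindex_inj (addIr (gam y))) /=.
under eq_bigr => r _ do rewrite addrK.
rewrite -[in RHS]sum1_card natr_sum [RHS]big_mkcond /=.
by apply: eq_bigr => r _; case: (r \in B).
Qed.

Variable M : R.
Hypothesis M_ge0 : 0 <= M.
Hypothesis charsum_bound : forall k, k != 0 -> nm (\sum_y tripsi k (gam y)) <= M.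

(** By Parseval, frequency 0 accounts for the mean, every other frequency carries a factor at most
    [M], and the squared transform of [B] sums to q^3 #|B|. *)
Lemma hits_variance :
  \sum_r (hits r - #|Y|%:R * #|B|%:R / q ^+ 3) ^+ 2 <= M ^+ 2 * #|B|%:R.
Proof.
have q0 : 0 < q by rewrite ltr0n card_field_gt0.
have q30 : 0 < q ^+ 3 by rewrite exprn_gt0.
set T := #|Y|%:R * #|B|%:R.
have -> : \sum_r (hits r - T / q ^+ 3) ^+ 2 = \sum_r hits r ^+ 2 - T ^+ 2 / q ^+ 3.
  transitivity (\sum_r (hits r ^+ 2 - 2 * (T / q ^+ 3) * hits r + (T / q ^+ 3) ^+ 2)).
    by apply: eq_bigr => r _; ring.
  rewrite big_split sumrB -mulr_sumr sum_hits /= -/T sumr_const -[X in _ + X]mulr_natl.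
  by rewrite card_triple; field; rewrite gt_eqF.
rewrite lerBlDr -(ler_pM2l q30) mulrDr.
have -> : q ^+ 3 * (T ^+ 2 / q ^+ 3) = T ^+ 2 by field; rewrite gt_eqF.
have <- : \sum_k nm (\sum_r (hits r)%:C%C * tripsi k r) ^+ 2 = q ^+ 3 * \sum_r hits r ^+ 2.
  rewrite parseval; congr (_ * _); apply: eq_bigr => r _.
  by rewrite nm_real real_normK ?num_real.
have PB : \sum_k nm (\sum_(b in B) tripsi k b) ^+ 2 = q ^+ 3 * #|B|%:R.
  rewrite (eq_bigr (fun k => nm (\sum_b (b \in B)%:R * tripsi k b) ^+ 2)); last first.
    move=> k _; rewrite big_mkcond /=; congr (nm _ ^+ 2); apply: eq_bigr => b _.
    by case: (b \in B); rewrite ?mul1r ?mul0r.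
  rewrite parseval; congr (_ * _); rewrite -sum1_card natr_sum [RHS]big_mkcond /=.
  by apply: eq_bigr => b _; rewrite nm_nat; case: (b \in B); rewrite ?expr1n ?expr0n.
rewrite (bigD1 (0 : V)) //= addrC; apply: lerD.
  apply: le_trans (_ : \sum_k M ^+ 2 * nm (\sum_(b in B) tripsi k b) ^+ 2 <= _).
    rewrite big_mkcond; apply: ler_sum => k _ /=; case: ifP => k0; last first.
      by rewrite mulr_ge0 ?sqr_ge0.
    rewrite sum_hits_tripsi nmM exprMn ler_wpM2r ?sqr_ge0 //.
    by rewrite lerXn2r ?nnegrE ?nm_ge0 // charsum_bound.
  by rewrite -mulr_sumr PB mulrCA.
rewrite sum_hits_tripsi nmM lerXn2r ?nnegrE ?mulr_ge0 ?nm_ge0 ?ler0n //.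
apply: ler_pM; rewrite ?nm_ge0 // -[leRHS]mulr1; apply: nm_sum_le => y _;
  by rewrite nm_tripsi.
Qed.

(* A point of the curve in [A] contributes [#|B|] to the sum of [hits] over [D];
   Chebyshev's inequality bounds that sum. *)
Lemma hits_upper_bound (eps : R) (A D : {set V}) :
  0 < eps <= 1 -> M <= eps ^+ 3 * q -> eps ^+ 3 * q ^+ 3 <= #|B|%:R ->
  (#|Y| <= #|F|)%N -> (forall a b, a \in A -> b \in B -> a + b \in D) ->
  #|[set y | gam y \in A]|%:R <= #|D|%:R / q ^+ 2 + eps * q.
Proof.
move=> /andP[eps0 eps1] Mle Ble Yle ABD.
have q0 : 0 < q by rewrite ltr0n card_field_gt0.
have q0' := ltW q0; have eps0' := ltW eps0.
have B0 : 0 < #|B|%:R :> R by apply: lt_le_trans Ble; rewrite mulr_gt0 ?exprn_gt0.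
set N := #|_|%:R; set lam := #|Y|%:R * #|B|%:R / q ^+ 3.
have le1 : #|B|%:R * N <= \sum_(r in D) hits r.
  rewrite /hits exchange_big /= mulrC mulr_natl -sumr_const big_mkcond /=.
  apply: ler_sum => y _; rewrite inE; case: ifP => yA; last first.
    by apply: sumr_ge0 => r _; rewrite ler0n.
  rewrite -sum1_card natr_sum big_mkcond [leRHS]big_mkcond /=.
  rewrite [leRHS](reindex_inj (addIr (gam y))) /=; apply: ler_sum => b _.
  rewrite addrK; case: (boolP (b \in B)) => bB; last by case: ifP.
  by rewrite (addrC b) ABD.
(* Cauchy-Schwarz over [D], which has at most q^3 elements. The cubes in the hypotheses are made for
   this: q^3 (eps^3 q)^2 #|B| = eps (eps q)^2 #|B| (eps^3 q^3) <= (eps q #|B|)^2. *)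
have le2 : (\sum_(r in D) (hits r - lam)) ^+ 2 <= (eps * q * #|B|%:R) ^+ 2.
  apply: le_trans (sqr_sum_le _ _) _.
  apply: le_trans (_ : q ^+ 3 * (M ^+ 2 * #|B|%:R) <= _).
    apply: ler_pM; rewrite ?ler0n //; first by apply: sumr_ge0 => r _; rewrite sqr_ge0.
      by rewrite -card_triple ler_nat max_card.
    apply: le_trans hits_variance; rewrite big_mkcond; apply: ler_sum => r _ /=.
    by case: ifP => // _; rewrite sqr_ge0.
  have M2 : M ^+ 2 <= (eps ^+ 3 * q) ^+ 2.
    by rewrite lerXn2r ?nnegrE ?mulr_ge0 ?exprn_ge0.
  apply: le_trans (_ : q ^+ 3 * ((eps ^+ 3 * q) ^+ 2 * #|B|%:R) <= _).
    by rewrite ler_pM2l ?exprn_gt0 // ler_pM2r.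
  have -> : q ^+ 3 * ((eps ^+ 3 * q) ^+ 2 * #|B|%:R) =
    eps * (q ^+ 2 * eps ^+ 2 * #|B|%:R * (eps ^+ 3 * q ^+ 3)) by ring.
  have -> : (eps * q * #|B|%:R) ^+ 2 = 1 * (q ^+ 2 * eps ^+ 2 * #|B|%:R * #|B|%:R) by ring.
  apply: ler_pM => //.
    by rewrite !mulr_ge0 ?exprn_ge0.
  by rewrite ler_wpM2l // !mulr_ge0 ?exprn_ge0.
have le3 : \sum_(r in D) (hits r - lam) <= eps * q * #|B|%:R.
  have e0 : 0 <= eps * q * #|B|%:R by rewrite !mulr_ge0 ?ler0n.
  apply: le_trans (ler_norm _) _.
  by rewrite -(ger0_norm e0) -ler_sqr ?nnegrE ?normr_ge0 // !real_normK ?num_real.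
have le4 : lam <= #|B|%:R / q ^+ 2.
  rewrite /lam ler_pdivrMr ?exprn_gt0 //.
  have -> : #|B|%:R / q ^+ 2 * q ^+ 3 = q * #|B|%:R by field; rewrite gt_eqF.
  by rewrite ler_pM2r // ler_nat.
rewrite -(ler_pM2l B0); apply: le_trans le1 _.
have -> : \sum_(r in D) hits r = \sum_(r in D) (hits r - lam) + #|D|%:R * lam.
  by rewrite sumrB sumr_const mulr_natl subrK.
rewrite mulrDr addrC; apply: lerD; last by rewrite mulrC.
by rewrite [leRHS]mulrCA ler_wpM2l ?ler0n.
Qed.

End BoxDiscrepancy.

(** * Centred representatives modulo an odd prime *)

Section PrimeField.
Variable p : nat.
Hypotheses (p_pr : prime p) (p_odd : odd p).
Implicit Types (a b y : 'F_p).

Lemma half_double : p = (half p).*2.+1.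
Proof.
rewrite /half; move: p_odd; have := prime_gt0 p_pr; case: p => // n _ /= /negbTE n2.
by rewrite -[in LHS](odd_double_half n) n2 add0n.
Qed.

Lemma half_gt0 : (0 < half p)%N.
Proof. by have := prime_gt1 p_pr; rewrite {1}half_double; case: (half p). Qed.

Lemma sum_Fp_val (V : nmodType) (f : nat -> V) :
  \sum_(a : 'F_p) f (val a) = \sum_(0 <= i < p) f i.
Proof. by rewrite -[in RHS](Fp_cast p_pr) big_mkord. Qed.

Lemma val_Fp_lt a : (val a < p)%N.
Proof. by have := ltn_ord a; rewrite [X in (_ < X)%N](Fp_cast p_pr). Qed.

Lemma sum_symrep (V : nmodType) (f : int -> V) :
  \sum_(a : 'F_p) f (symrep a) = \sum_(0 <= i < p) f (i%:Z - (half p)%:Z).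
Proof.
rewrite (sum_Fp_val (fun n => f (if (n <= half p)%N then n%:Z else n%:Z - p%:Z))).
have pE := half_double; set J := half p in pE *.
rewrite (@big_cat_nat _ _ _ J.+1) //=; last by rewrite pE; lia.
rewrite [RHS](@big_cat_nat _ _ _ J) //=; last by rewrite pE; lia.
rewrite addrC; congr (_ + _).
  rewrite -{1}(add0n J.+1) big_addn; have -> : (p - J.+1 = J)%N by rewrite pE; lia.
  rewrite big_nat [RHS]big_nat; apply: eq_bigr => i /andP[_ iJ].
  by rewrite leqNgt ltn_addl //=; congr f; rewrite pE; lia.
rewrite -[in RHS](add0n J) big_addn; have -> : (p - J = J.+1)%N by rewrite pE; lia.
rewrite big_nat [RHS]big_nat; apply: eq_bigr => i /andP[_ iJ].
by rewrite -ltnS iJ; congr f; lia.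
Qed.

Lemma symrep_bounds a : - (half p)%:Z <= symrep a <= (half p)%:Z.
Proof.
rewrite /symrep; have := val_Fp_lt a; have := half_double.
by move: (val a) (half p) => n J; case: (leqP n J); lia.
Qed.

Lemma symrepK a : (symrep a)%:~R = a.
Proof.
have e : (val a)%:R = a by rewrite natr_Zp.
rewrite /symrep; case: ifP => _; first exact: e.
by rewrite rmorphB /= -!pmulrn e pcharf0 ?subr0 // pchar_Fp.
Qed.

Lemma symrep_int (z : int) : - (half p)%:Z <= z <= (half p)%:Z ->
  symrep (z%:~R : 'F_p) = z.
Proof.
move=> zJ; have wJ := symrep_bounds z%:~R; have e := symrepK z%:~R.
move: wJ e; set w := symrep _ => wJ /eqP; rewrite -subr_eq0 -rmorphB /=.
have pE := half_double => e.
have : (p %| `|(w - z)%R|)%N.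
  rewrite (dvdn_pcharf (pchar_Fp p_pr)); move: e.
  by case: (w - z) => n; rewrite ?NegzE ?mulrNz ?oppr_eq0 ?abszN -pmulrn.
have : (`|(w - z)%R| < p)%N by lia.
by case: (posnP `|w - z|%N) => [|/dvdn_leq le lt /le]; lia.
Qed.

End PrimeField.

(** * Additive characters modulo p and the curve *)

Section CurveCharacterSums.
Variable R : rcfType.

(** For a root z of 1 + X + ... + X^(p-1) in the algebraically closed field [R[i]], x -> z^x works:
    z^p = 1 makes it a homomorphism of modulus 1, and the root equation is the vanishing of the
    sum. *)
Lemma Fp_additive_character p : prime p -> exists psi : 'F_p -> R[i],
  [/\ forall x y, psi (x + y) = psi x * psi y, forall x, nm (psi x) = 1 & \sum_x psi x = 0].
Proof.
move=> p_pr; have p1 := prime_gt1 p_pr.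
have [z rz] : exists z : R[i], root (\poly_(i < p) 1) z.
  apply/closed_rootP; rewrite size_poly_eq ?oner_eq0 //.
  by rewrite neq_ltn p1 orbT.
have sz : \sum_(0 <= i < p) z ^+ i = 0.
  move: rz; rewrite /root horner_poly big_mkord => /eqP e; rewrite -[RHS]e.
  by apply: eq_bigr => i _; rewrite mul1r.
have zp : z ^+ p = 1.
  apply/eqP; rewrite -subr_eq0 subrX1; move: (sz); rewrite big_mkord => ->.
  by rewrite mulr0.
exists (fun x => z ^+ val x); split=> [x y|x|].
- have -> : val (x + y) = ((val x + val y) %% p)%N.
    by rewrite /= [X in (_ %% X)%N = _](Fp_cast p_pr).
  by rewrite -exprD /= {2}(divn_eq (x + y) p) exprD mulnC exprM zp expr1n mul1r.
- have n1 : nm z ^+ p = 1.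
    have nmX n : nm (z ^+ n) = nm z ^+ n.
      by elim: n => [|n IH]; rewrite ?expr0 ?nm1 // !exprS nmM IH.
    by rewrite -nmX zp nm1.
  have -> : nm (z ^+ val x) = nm z ^+ val x.
    by elim: (val x) => [|n IH]; rewrite ?expr0 ?nm1 // !exprS nmM IH.
  have /eqP := n1; rewrite pexprn_eq1 ?nm_ge0 ?(prime_gt0 p_pr) //.
  by rewrite gtn_eqF ?(prime_gt0 p_pr) //= => /eqP->; rewrite expr1n.
- by rewrite (sum_Fp_val p_pr (fun n => z ^+ n)).
Qed.

(* With [n + h = y^-1], the first coordinate [n^-1] is [y / (1 - h y)]; this is
   its partial fraction form in [y]. *)
Definition xi p (h y : 'F_p) : 'F_p := h ^- 2 / (h^-1 - y) - h^-1.

Definition curve p (h y : 'F_p) := (y, xi h y, xi h (y + 1)).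

Lemma xiE p (h y : 'F_p) : prime p -> h != 0 -> y != 0 -> y != h^-1 ->
  xi h y = (y^-1 - h)^-1.
Proof.
move=> p_pr h0 y0 yh; have hy : 1 - h * y != 0.
  by apply: contraNneq yh => /eqP; rewrite subr_eq0 => /eqP e; rewrite -[y](mulKf h0) -e mulr1.
have e1 : h^-1 - y = (1 - h * y) / h by field.
have e2 : y^-1 - h = (1 - h * y) / y by field.
by rewrite /xi e1 e2; field; rewrite hy h0 y0.
Qed.

(** With w = h^-1 - y the poles of [xi h y] and [xi h (y + 1)] lie at w = 0 and w = 1, and the sum
    is [charsum] up to a unimodular factor and the two terms at the poles, where division by 0 gives
    some value. *)
Lemma curve_charsum_le (eps : R) : 0 < eps <= 1 -> exists Q : R, forall p (h : 'F_p)
    (psi : 'F_p -> R[i]),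
  prime p -> odd p -> h != 0 -> Q <= p%:R ->
  (forall x y, psi (x + y) = psi x * psi y) -> (forall x, nm (psi x) = 1) ->
  \sum_x psi x = 0 ->
  forall k, k != 0 -> nm (\sum_y tripsi psi k (curve h y)) <= eps * p%:R.
Proof.
(* Half of [eps] goes to [charsum], through [62 * delta = (eps / 2) ^+ 4], and the other half to the
   two pole terms, through [4 / eps <= p]. *)
move=> /andP[eps0 eps1]; pose delta := (eps / 2) ^+ 4 / 62.
have delta0 : 0 < delta by rewrite divr_gt0 ?exprn_gt0 ?divr_gt0.
have delta1 : delta <= 1.
  rewrite /delta ler_pdivrMr // mul1r; apply: le_trans (_ : 1 <= _); last by rewrite ler1n.
  by rewrite exprn_ile1 //; lra.
exists (7 / delta ^+ 4 + 4 / eps); move=> p h psi p_pr p_odd h0 Qp psiD nm_psi sum_psi k k0.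
have Q1 : 7 / delta ^+ 4 <= p%:R by apply: le_trans Qp; rewrite lerDl divr_ge0 ?ltW.
have Q2 : 4 / eps <= p%:R by apply: le_trans Qp; rewrite lerDr divr_ge0 ?exprn_ge0 ?(ltW delta0).
have two0 : (2 : 'F_p) != 0.
  rewrite -(dvdn_pcharf (pchar_Fp p_pr)); apply/negP => /dvdn_leq -/(_ isT).
  by move: p_odd (prime_gt1 p_pr); case: (p) => [|[|[|]]].
have cardE : (#|'F_p|%:R : R) = p%:R by rewrite card_Fp.
pose S := charsum psi (k.1.2 * h ^- 2) (k.2 * h ^- 2) (- k.1.1).
have Sle : nm S <= eps / 2 * p%:R.
  have : nm S ^+ 4 <= (eps / 2 * p%:R) ^+ 4.
    have -> : (eps / 2 * p%:R) ^+ 4 = 62 * delta * #|'F_p|%:R ^+ 4.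
      by rewrite cardE /delta exprMn; field.
    apply: charsum_le => //.
      by rewrite cardE mulrC -ler_pdivrMr ?exprn_gt0.
    rewrite oppr_eq0 !mulf_eq0 !invr_eq0 !expf_eq0 (negPf h0) !orbF.
    move: k0; case: k {S} => -[a b] c /=; apply: contraNT.
    by rewrite !negb_or !negbK => /and3P[/eqP-> /eqP-> /eqP->].
  by rewrite ler_pXn2r ?nnegrE ?nm_ge0 // mulr_ge0 ?ler0n //; lra.
have -> : \sum_y tripsi psi k (curve h y) =
   psi ((k.1.1 - k.1.2 - k.2) / h) * S +
   (tripsi psi k (curve h h^-1) + tripsi psi k (curve h (h^-1 - 1))).
  rewrite (reindex_inj (subrI h^-1)) (bigD1 0) //= subr0 (bigD1 1) ?oner_eq0 //=.
  rewrite addrA addrC; congr (_ + _); rewrite /S /charsum mulr_sumr.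
  apply: eq_bigr => w /andP[w0 w1]; rewrite /tripsi -psiD; congr psi.
  rewrite /curve /xi /=; have -> : h^-1 - (h^-1 - w) = w by ring.
  have -> : h^-1 - (h^-1 - w + 1) = w - 1 by ring.
  by field; rewrite w0 h0 subr_eq0 w1.
apply: le_trans (nmD _ _) _; rewrite nmM nm_psi mul1r.
have := nmD (tripsi psi k (curve h h^-1)) (tripsi psi k (curve h (h^-1 - 1))).
rewrite !nm_tripsi //; move: Q2; rewrite ler_pdivrMr // (mulrC _ eps).
by move: Sle; rewrite mulrAC; lra.
Qed.

Lemma curve_upper_bound (eps : R) : 0 < eps <= 1 -> exists Q : R, forall p (h : 'F_p)
    (A B D : {set 'F_p * 'F_p * 'F_p}),
  prime p -> odd p -> h != 0 -> Q <= p%:R -> eps ^+ 3 * p%:R ^+ 3 <= #|B|%:R ->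
  (forall a b, a \in A -> b \in B -> a + b \in D) ->
  #|[set y | curve h y \in A]|%:R <= #|D|%:R / p%:R ^+ 2 + eps * p%:R.
Proof.
move=> /andP[eps0 eps1]; have eps31 : 0 < eps ^+ 3 <= 1.
  by rewrite exprn_gt0 //= exprn_ile1 // ltW.
have [Q HQ] := curve_charsum_le eps31; exists Q; move=> p h A B D p_pr p_odd h0 Qp Ble ABD.
have [psi [psiD nm_psi sum_psi]] := Fp_additive_character p_pr.
have cE : (p%:R : R) = #|'F_p|%:R by rewrite card_Fp.
have M0 : 0 <= eps ^+ 3 * p%:R by rewrite mulr_ge0 ?ler0n // ltW //; case/andP: eps31.
rewrite !cE; apply: (hits_upper_bound psiD nm_psi sum_psi M0 (B := B)) => //.
- by move=> k k0; apply: HQ.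
- by rewrite eps0.
- by rewrite cE.
- by rewrite -cE.
Qed.

End CurveCharacterSums.

(** * The limiting distribution *)

Section TailMass.
Variable R : realType.
Implicit Types nu x y : R.

(* An antiderivative of [x |-> (2 - nu / x) ^+ 2]; for [0 < u <= 1] and [nu <= 2 u]
   the square is twice the area of the set of (v, w) in [-1, 1]^2 with
   u (w - v) >= nu. *)
Definition tail_primitive nu x : R := 4 * x - 4 * nu * ln x - nu ^+ 2 * x^-1.

(** For [nu >= 0] this is the volume of the set u (w - v) >= nu in [-1, 1]^3: the slices at u and -
    u have the same area, half the integrand each. The lower limit is the zero of the integrand, and
    the maximum makes the mass 0 for [nu >= 2]. *)
Definition tail_mass nu : R :=
  tail_primitive nu (Num.max 1 (nu / 2)) - tail_primitive nu (nu / 2).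

Lemma is_derive_tail_primitive nu x : 0 < x ->
  is_derive x 1 (tail_primitive nu) ((2 - nu / x) ^+ 2).
Proof.
move=> x0; have xn0 : x != 0 by rewrite gt_eqF.
have dl := is_derive1_ln x0.
have di : is_derive x 1 (fun y : R => y^-1) (- x ^- 2 *: 1).
  exact: (@is_deriveV _ id).
have -> : tail_primitive nu = 4 *: id - (4 * nu) *: @ln R - nu ^+ 2 *: (fun y : R => y^-1) by [].
apply: is_derive_eq; rewrite /GRing.scale /= !mulr1.
by field.
Qed.

(** The mean value theorem, with a derivative that is nondecreasing from nu / 2 on. *)
Lemma tail_primitive_bounds nu x y : 0 < nu -> nu / 2 <= x -> x <= y ->
  (2 - nu / x) ^+ 2 * (y - x) <= tail_primitive nu y - tail_primitive nu x
    <= (2 - nu / y) ^+ 2 * (y - x).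
Proof.
move=> nu0 nux xy; have x0 : 0 < x by lra.
have y0 : 0 < y by lra.
have [c| |c] := @MVT_segment R (tail_primitive nu) (fun c => (2 - nu / c) ^+ 2) x y xy.
- by rewrite in_itv /= => /andP[xc _]; apply: is_derive_tail_primitive; lra.
- apply: derivable_within_continuous => c; rewrite in_itv /= => /andP[xc _].
  by have [] := @is_derive_tail_primitive nu c (lt_le_trans x0 xc).
rewrite in_itv /= => /andP[xc cy] ->; have c0 : 0 < c by lra.
have le2 z : nu / 2 <= z -> 0 < z -> nu / z <= 2.
  by move=> nuz z0; rewrite ler_pdivrMr //; lra.
have mono z w : nu / 2 <= z -> 0 < z -> z <= w -> (2 - nu / z) ^+ 2 <= (2 - nu / w) ^+ 2.
  move=> nuz z0 zw; have w0 : 0 < w by lra.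
  have h1 := le2 z nuz z0; have h2 : nu / w <= nu / z.
    by rewrite ler_pM2l // lef_pV2 ?posrE.
  by rewrite lerXn2r ?nnegrE; lra.
by apply/andP; split; apply: ler_wpM2r; rewrite ?subr_ge0 //; apply: mono => //; lra.
Qed.

Lemma tail_mass0 : tail_mass 0 = 4.
Proof.
rewrite /tail_mass /tail_primitive mul0r max_l // expr0n /= !(mul0r, mulr0).
by ring.
Qed.

(** Right endpoint sums of a nondecreasing function with values in [0, 4]: they exceed the integral
    by no more than the last term. *)
Lemma tail_riemann_sum nu (J : nat) : 0 <= nu -> (0 < J)%N ->
  J%:R * tail_mass nu <= \sum_(1 <= u < J.+1) Num.max 0 (2 - nu * (J%:R / u%:R)) ^+ 2
    <= J%:R * tail_mass nu + 4.
Proof.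
move=> nu0 J0; have J0' : 0 < J%:R :> R by rewrite ltr0n.
move: nu0; rewrite le_eqVlt => /orP[/eqP <-|nu0].
  rewrite tail_mass0 (eq_bigr (fun=> 4)) => [|u _]; last first.
    by rewrite mul0r subr0 max_r // -natrX.
  by rewrite sumr_const_nat subn1 /= -[4 *+ J]mulr_natl lexx lerDl ler0n.
(* Clipping the nodes at nu / 2 starts the partition where the integrand vanishes, so that the
   primitives telescope to [tail_mass]. *)
pose X u : R := Num.max (u%:R / J%:R) (nu / 2).
pose c u : R := Num.max 0 (2 - nu * (J%:R / u%:R)) ^+ 2.
have Xge u : nu / 2 <= X u by rewrite le_max lexx orbT.
have cE u : (0 < u)%N -> c u = (2 - nu / X u) ^+ 2.
  move=> u0; have u0' : 0 < u%:R :> R by rewrite ltr0n.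
  have e : nu * (J%:R / u%:R) = nu / (u%:R / J%:R) by field; rewrite !gt_eqF.
  rewrite /c /X e; case: (leP (nu / 2) (u%:R / J%:R)) => h.
    rewrite max_r // subr_ge0 ler_pdivrMr ?divr_gt0 //; lra.
  rewrite max_l; last first.
    rewrite subr_le0 ler_pdivlMr ?divr_gt0 //; lra.
  by congr (_ ^+ 2); field; rewrite gt_eqF.
have Xmono u : X u <= X u.+1.
  rewrite /X ge_max; apply/andP; split; last exact: Xge.
  by rewrite le_max ler_pM2r ?invr_gt0 // ler_nat leqnSn.
have Xdiff u : X u.+1 - X u <= J%:R^-1.
  have e : u.+1%:R / J%:R = u%:R / J%:R + J%:R^-1 :> R by rewrite -natr1 mulrDl mul1r.
  rewrite lerBlDr /X e ge_max; apply/andP; split.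
    by rewrite addrC lerD2l le_max lexx.
  have : nu / 2 <= Num.max (u%:R / J%:R) (nu / 2) by rewrite le_max lexx orbT.
  by have : 0 < J%:R^-1 :> R by [rewrite invr_gt0]; lra.
have X0 : X 0%N = nu / 2 by rewrite /X mul0r max_r //; lra.
have XJ : X J = Num.max 1 (nu / 2) by rewrite /X divff // gt_eqF.
have bd u := tail_primitive_bounds nu0 (Xge u) (Xmono u).
have massE : tail_mass nu = \sum_(0 <= u < J) (tail_primitive nu (X u.+1) - tail_primitive nu (X u)).
  by rewrite (telescope_sumr (fun u => tail_primitive nu (X u))) // /tail_mass X0 XJ.
apply/andP; split.
  rewrite massE mulr_sumr big_add1 /=; apply: ler_sum => u _.
  have /andP[_ h] := bd u; apply: le_trans (_ : J%:R * ((2 - nu / X u.+1) ^+ 2 * J%:R^-1) <= _).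
    by rewrite ler_pM2l //; apply: le_trans h _; rewrite ler_wpM2l ?sqr_ge0.
  by rewrite -/(c u.+1) cE // mulrCA divff ?mulr1 // gt_eqF.
rewrite big_nat_recr //=; apply: lerD; last first.
  have : nu * (J%:R / J%:R) = nu by rewrite divff ?mulr1 // gt_eqF.
  move=> ->; have -> : (4 : R) = 2 ^+ 2 by rewrite -natrX.
  rewrite lerXn2r ?nnegrE // ?le_max ?lexx // ge_max; apply/andP; split; lra.
rewrite massE mulr_sumr [leRHS]big_ltn // addrC -[leLHS]addr0.
apply: lerD; last first.
  rewrite mulr_ge0 ?ler0n //; have /andP[h _] := bd 0%N; apply: le_trans h.
  by rewrite mulr_ge0 ?sqr_ge0 // subr_ge0.
rewrite big_nat [leRHS]big_nat; apply: ler_sum => u /andP[u0 _].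
rewrite -/(c u) cE //; have /andP[h _] := bd u.
case: (leP (u%:R / J%:R) (nu / 2)) => hX.
  have XE : X u = nu / 2 by rewrite /X max_r.
  move: h; rewrite XE; have -> : nu / (nu / 2) = 2 by field; rewrite gt_eqF.
  by rewrite subrr expr0n mul0r => h; rewrite mulr_ge0 ?ler0n.
have XE : X u.+1 - X u = J%:R^-1.
  have e : u.+1%:R / J%:R = u%:R / J%:R + J%:R^-1 :> R by rewrite -natr1 mulrDl mul1r.
  rewrite /X !max_l ?e; first by rewrite addrC addKr.
    by rewrite ltW.
  by apply: le_trans (ltW hX) _; rewrite lerDl invr_ge0 ler0n.
apply: le_trans (_ : J%:R * ((2 - nu / X u) ^+ 2 * J%:R^-1) <= _).
  by rewrite mulrCA divff ?mulr1 // gt_eqF.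
by rewrite ler_pM2l // -XE.
Qed.

Lemma tail_mass_expr nu : 0 < nu -> tail_mass nu =
  4 * Num.max 1 (nu / 2) - 4 * nu * ln (Num.max 1 (nu / 2))
   - nu ^+ 2 * (Num.max 1 (nu / 2))^-1 + 4 * nu * ln (nu / 2).
Proof.
move=> nu0; rewrite /tail_mass /tail_primitive; set l := ln (nu / 2).
set M := Num.max _ _; set lM := ln M; set iM := M^-1.
have -> : nu ^+ 2 * (nu / 2)^-1 = 2 * nu by field; rewrite gt_eqF.
by field.
Qed.

Lemma tail_mass_le2 nu : 0 < nu <= 2 ->
  tail_mass nu = 4 - nu ^+ 2 - 4 * nu * ln (2 / nu).
Proof.
move=> /andP[nu0 nu2]; rewrite tail_mass_expr // max_l ?ln1 ?invr1; last by lra.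
have -> : 2 / nu = (nu / 2)^-1 by field; rewrite gt_eqF.
by rewrite lnV ?posrE ?divr_gt0 //; ring.
Qed.

Lemma tail_mass_ge2 nu : 2 <= nu -> tail_mass nu = 0.
Proof.
by move=> nu2; rewrite /tail_mass max_r ?subrr //; lra.
Qed.

Lemma ln_ge_1BV x : 0 < x -> 1 - x^-1 <= ln x.
Proof.
move=> x0; have := @le_ln1Dx R (x^-1 - 1).
have -> : 1 + (x^-1 - 1) = x^-1 by ring.
by rewrite lnV ?posrE // => h; have : 0 < x^-1 by [rewrite invr_gt0]; lra.
Qed.

(* The comparison [ln s >= 1 - 1 / s] at [nu = 2 s ^ 2] beats the logarithmic
   singularity of [tail_mass] at 0. *)
Lemma tail_mass_near0 x : 0 < x <= 1 -> 4 - 16 * x <= tail_mass (2 * x ^+ 2).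
Proof.
move=> /andP[x0 x1]; have x2 : x ^+ 2 <= 1 by rewrite exprn_ile1 // ltW.
have x20 : 0 < x ^+ 2 by rewrite exprn_gt0.
rewrite tail_mass_expr ?mulr_gt0 // mulrAC divff // mul1r.
rewrite max_l // ln1 invr1 lnXn // mulr2n.
have := ln_ge_1BV x0; rewrite -(ler_pM2l x20).
have -> : x ^+ 2 * (1 - x^-1) = x ^+ 2 - x by field; rewrite gt_eqF.
move: (ln x) => l h; have : (x ^+ 2) ^+ 2 <= x ^+ 2 by rewrite expr2 ler_piMl // ltW.
rewrite exprMn; lra.
Qed.

Lemma continuous_tail_mass nu : 0 < nu -> {for nu, continuous tail_mass}.
Proof.
move=> nu0; have key (m : R -> R) : 0 < m nu -> {for nu, continuous m} ->
    (tail_primitive x (m x) @[x --> nu] --> tail_primitive nu (m nu))%classic.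
  move=> m0 cm; apply: cvgB; first apply: cvgB.
  - by apply: cvgM; [exact: cvg_cst|exact: cm].
  - apply: cvgM; first by apply: cvgM; [exact: cvg_cst|exact: cvg_id].
    by apply: (cvg_comp m (@ln R) cm); exact: continuous_ln.
  - apply: cvgM; first by apply: cvgM; exact: cvg_id.
    by apply: cvgV => //; rewrite gt_eqF.
have half_cont : {for nu, continuous (fun x : R => x / 2)}.
  by apply: cvgM; [exact: cvg_id|exact: cvg_cst].
apply: cvgB; last by apply: (key (fun x => x / 2)) => //; rewrite divr_gt0.
apply: (key (fun x => Num.max 1 (x / 2))); first by rewrite lt_max ltr01.
by apply: (@continuous_max R R (fun=> 1) (fun x => x / 2)) => //; exact: cvg_cst.
Qed.

(** One formula for both signs: for [nu <= 0] the complement is measured, and exchanging v and w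
    turns it into the case of - nu. The 4 is [tail_mass 0], half of the volume 8 of the cube. *)
Definition tail_prob nu : R :=
  (tail_mass (Num.max nu 0) + 4 - tail_mass (Num.max (- nu) 0)) / 8.

Lemma tail_probN nu : tail_prob nu + tail_prob (- nu) = 1.
Proof. by rewrite /tail_prob opprK; field. Qed.

Lemma tail_prob_gt0 nu : 0 < nu -> tail_prob nu = tail_mass nu / 8.
Proof.
by move=> nu0; rewrite /tail_prob max_l ?max_r ?tail_mass0; [field|lra|lra].
Qed.

Lemma tail_prob_le0 nu : nu <= 0 -> tail_prob nu = 1 - tail_mass (- nu) / 8.
Proof.
by move=> nu0; rewrite /tail_prob max_r ?max_l ?tail_mass0; [field|lra|lra].
Qed.

(** One-sided control is all that the replacement of nu by nu - delta asks for. At nu = 0, where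
    [continuous_tail_mass] does not apply, the width [2 * x ^+ 2] is the one at which
    [tail_mass_near0] loses only 16 x. *)
Lemma tail_prob_left nu (eps : R) : 0 < eps ->
  exists2 delta : R, 0 < delta & tail_prob (nu - delta) <= tail_prob nu + eps.
Proof.
move=> eps0; have close x : 0 < x -> exists2 d : R, 0 < d &
    forall y, `|y - x| <= d -> `|tail_mass x - tail_mass y| <= eps.
  move=> x0; have /cvgrPdist_le/(_ eps eps0) := continuous_tail_mass x0.
  move=> /nbhs_ballP[d /= d0 H]; exists (d / 2); first by rewrite divr_gt0.
  move=> y yx; apply: H; rewrite /ball /= distrC; lra.
have [nu0|nu0|nu0] := ltgtP nu 0.
- have [d d0 H] := close (- nu) ltac:(lra); exists d => //.
  rewrite !tail_prob_le0; try lra.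
  have := H (- (nu - d)); have -> : - (nu - d) - - nu = d by ring.
  rewrite gtr0_norm // => /(_ (lexx _)); rewrite ler_norml; lra.
- have [d d0 H] := close nu nu0; pose d' := Num.min d (nu / 2).
  have d'0 : 0 < d' by rewrite lt_min d0 divr_gt0.
  have d'd : d' <= d by rewrite ge_min lexx.
  have d'n : d' <= nu / 2 by rewrite ge_min lexx orbT.
  exists d' => //; rewrite !tail_prob_gt0; try lra.
  have := H (nu - d'); have -> : nu - d' - nu = - d' by ring.
  rewrite normrN gtr0_norm // => /(_ d'd); rewrite ler_norml; lra.
- pose x := Num.min 1 (eps / 2); have x01 : 0 < x <= 1.
    by rewrite lt_min ltr01 divr_gt0 //= ge_min lexx.
  have xe : x <= eps / 2 by rewrite ge_min lexx orbT.
  exists (2 * x ^+ 2); first by case/andP: x01 => x0 _; rewrite mulr_gt0 ?exprn_gt0.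
  have x2 : 0 <= x ^+ 2 by rewrite sqr_ge0.
  rewrite nu0 !tail_prob_le0; try lra.
  rewrite sub0r opprK oppr0 tail_mass0; have := tail_mass_near0 x01; lra.
Qed.

End TailMass.

(** * Lattice points in the region u (w - v) >= nu J^2 *)

Section LatticeCount.
Variable R : realType.
Implicit Types (x d nu : R) (J n : nat).

Local Notation pos x := (Num.max 0 x).

Lemma count_ge_le x n : 0 <= x ->
  \sum_(0 <= k < n) (x <= k%:R)%R%:R <= pos (n%:R - x).
Proof.
move=> x0; elim: n => [|n IH]; first by rewrite big_geq // le_max lexx.
rewrite big_nat_recr //= -natr1; case: (leP x n%:R) => h /=.
  apply: le_trans (lerD IH (lexx _)) _; rewrite max_r ?subr_ge0 // max_r; lra.
by rewrite addr0; apply: le_trans IH _; rewrite max_l ?le_max ?lexx //; lra.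
Qed.

Lemma count_gt_ge x n : 0 <= x ->
  pos (n%:R - 1 - x) <= \sum_(0 <= k < n) (x < k%:R)%R%:R.
Proof.
move=> x0; elim: n => [|n IH]; first by rewrite big_geq // max_l //; lra.
rewrite big_nat_recr //= -natr1 addrK; case: (ltP x n%:R) => h /=.
  apply: le_trans (lerD IH (lexx _)).
  have h1 : n%:R - 1 - x <= pos (n%:R - 1 - x) by rewrite le_max lexx orbT.
  by rewrite [leLHS]max_r; lra.
rewrite addr0 max_l; last by lra.
by apply: sumr_ge0 => k _; rewrite ler0n.
Qed.

(** Together with the next lemma, this makes half the square of the positive part a discrete
    antiderivative, so that the pair counts telescope. *)
Lemma pos_le_half_sqr_diff x : pos x <= (pos (x + 1) ^+ 2 - pos x ^+ 2) / 2.
Proof.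
have [x0|x0] := leP 0 x; first by rewrite max_r ?addr_ge0 //; nra.
by rewrite expr0n subr0 divr_ge0 ?sqr_ge0.
Qed.

Lemma half_sqr_diff_le_pos x : (pos x ^+ 2 - pos (x - 1) ^+ 2) / 2 <= pos x.
Proof.
have [x0|x0] := leP 0 x; last first.
  by rewrite expr0n /=; have := sqr_ge0 (pos (x - 1)); lra.
have [x1|x1] := leP 0 (x - 1); first by nra.
by rewrite expr0n /=; nra.
Qed.

(** The 1 added to n is the price of exact telescoping; it only affects lower order terms. *)
Lemma count_pairs_ge_le d n : 0 <= d ->
  \sum_(0 <= j < n) \sum_(0 <= k < n) (d <= k%:R - j%:R)%R%:R
    <= pos (n%:R + 1 - d) ^+ 2 / 2.
Proof.
move=> d0; apply: le_trans (_ : \sum_(0 <= j < n)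
   - (pos (n%:R + 1 - d - j.+1%:R) ^+ 2 / 2 - pos (n%:R + 1 - d - j%:R) ^+ 2 / 2) <= _).
  apply: ler_sum => j _; under eq_bigr => k _ do rewrite lerBrDr.
  apply: le_trans (count_ge_le _ _) _; first by rewrite addr_ge0.
  apply: le_trans (pos_le_half_sqr_diff _) _; rewrite opprB -mulrBl -(natr1 j).
  have -> : n%:R - (d + j%:R) + 1 = n%:R + 1 - d - j%:R by ring.
  by have -> : n%:R - (d + j%:R) = n%:R + 1 - d - (j%:R + 1) by ring.
rewrite sumrN (telescope_sumr (fun j => pos (n%:R + 1 - d - j%:R) ^+ 2 / 2)) //.
by rewrite opprB subr0 gerBl divr_ge0 ?sqr_ge0.
Qed.

Lemma count_pairs_gt_ge d n : 0 <= d ->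
  pos (n%:R - 1 - d) ^+ 2 / 2
    <= \sum_(0 <= j < n) \sum_(0 <= k < n) (d < k%:R - j%:R)%R%:R.
Proof.
move=> d0; apply: le_trans (_ : _ <= \sum_(0 <= j < n)
   - (pos (n%:R - 1 - d - j.+1%:R) ^+ 2 / 2 - pos (n%:R - 1 - d - j%:R) ^+ 2 / 2)) _.
  rewrite sumrN (telescope_sumr (fun j => pos (n%:R - 1 - d - j%:R) ^+ 2 / 2)) //.
  rewrite opprB subr0 (_ : pos (n%:R - 1 - d - n%:R) = 0) ?expr0n ?mul0r ?subr0 //.
  by rewrite max_l //; lra.
apply: ler_sum => j _; under [leRHS]eq_bigr => k _ do rewrite ltrBrDr.
apply: le_trans (count_gt_ge _ _); last by rewrite addr_ge0.
rewrite opprB -mulrBl -(natr1 j).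
have -> : n%:R - 1 - d - (j%:R + 1) = n%:R - 1 - (d + j%:R) - 1 by ring.
have -> : n%:R - 1 - d - j%:R = n%:R - 1 - (d + j%:R) by ring.
exact: half_sqr_diff_le_pos.
Qed.

Lemma sum_centered (V : nmodType) (H : int -> V) J :
  \sum_(0 <= i < J.*2.+1) H (i%:Z - J%:Z) = H 0 + \sum_(1 <= u < J.+1) (H u%:Z + H (- u%:Z)).
Proof.
rewrite (@big_cat_nat _ _ _ J) //=; last by lia.
rewrite [X in _ + X]big_ltn; last by lia.
rewrite subrr addrCA; congr (_ + _); rewrite big_split /= addrC; congr (_ + _).
  rewrite -(add0n J.+1) big_addn [RHS]big_add1 /=.
  have -> : (J.*2.+1 - J.+1 = J)%N by lia.
  by apply: eq_bigr => i _; congr H; lia.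
rewrite big_nat_rev /= add0n [RHS]big_add1 /= big_nat [RHS]big_nat.
by apply: eq_bigr => i /andP[_ iJ]; congr H; lia.
Qed.

Variable p : nat.
Hypotheses (p_pr : prime p) (p_odd : odd p).
Local Notation J := (half p).
Local Notation V := ('F_p * 'F_p * 'F_p)%type.

Lemma card_symrep_set (P : int -> int -> int -> bool) :
  #|[set r : V | P (symrep r.1.1) (symrep r.1.2) (symrep r.2)]|%:R =
  \sum_(0 <= i < p) \sum_(0 <= j < p) \sum_(0 <= k < p)
     (P (i%:Z - J%:Z) (j%:Z - J%:Z) (k%:Z - J%:Z))%:R :> R.
Proof.
rewrite -sum1_card natr_sum big_mkcond /=.
transitivity (\sum_(a : 'F_p) \sum_(b : 'F_p) \sum_(c : 'F_p)
    (P (symrep a) (symrep b) (symrep c))%:R : R).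
  rewrite pair_bigA /= pair_bigA /=; apply: eq_bigr => r _.
  by rewrite inE; case: (P _ _ _).
rewrite (sum_symrep p_pr p_odd (fun u =>
  \sum_(b : 'F_p) \sum_(c : 'F_p) (P u (symrep b) (symrep c))%:R)).
apply: eq_bigr => i _.
rewrite (sum_symrep p_pr p_odd (fun v => \sum_(c : 'F_p) (P _ v (symrep c))%:R)).
apply: eq_bigr => j _.
by rewrite (sum_symrep p_pr p_odd (fun w => (P _ _ w)%:R)).
Qed.

Definition tilt_form (u v w : int) : R := u%:~R * (w%:~R - v%:~R).

Definition tilt nu : {set V} :=
  [set r | nu * J%:R ^+ 2 <= tilt_form (symrep r.1.1) (symrep r.1.2) (symrep r.2)].

(** Each clipped term is at most J c + 2 with 0 <= c <= 2, whose square exceeds (J c)^2 by at most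
    12 J; J such errors and the 4 J^2 of the Riemann sum make 16 J^2. *)
Lemma sum_clip_le nu : 0 <= nu ->
  \sum_(1 <= u < J.+1) pos (2 * J%:R + 2 - nu * J%:R ^+ 2 / u%:R) ^+ 2
    <= J%:R ^+ 3 * tail_mass nu + 16 * J%:R ^+ 2.
Proof.
move=> nu0; have J0 := half_gt0 p_pr p_odd; have J1 : 1 <= J%:R :> R by rewrite ler1n.
have /andP[_ rs] := tail_riemann_sum nu0 J0.
apply: le_trans (_ : \sum_(1 <= u < J.+1)
   (J%:R ^+ 2 * pos (2 - nu * (J%:R / u%:R)) ^+ 2 + 12 * J%:R) <= _).
  rewrite big_nat [leRHS]big_nat; apply: ler_sum => u /andP[u1 _].
  set c := pos (2 - _); have c0 : 0 <= c by rewrite le_max lexx.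
  have c2 : c <= 2.
    by rewrite ge_max; apply/andP; split=> //; rewrite gerBl mulr_ge0 ?divr_ge0.
  have cx : 2 - nu * (J%:R / u%:R) <= c by rewrite le_max lexx orbT.
  have h : pos (2 * J%:R + 2 - nu * J%:R ^+ 2 / u%:R) <= J%:R * c + 2.
    rewrite ge_max; apply/andP; split; first by nra.
    have -> : nu * J%:R ^+ 2 / u%:R = J%:R * (nu * (J%:R / u%:R)) by ring.
    nra.
  have h0 : 0 <= pos (2 * J%:R + 2 - nu * J%:R ^+ 2 / u%:R) by rewrite le_max lexx.
  apply: le_trans (_ : (J%:R * c + 2) ^+ 2 <= _).
    by rewrite lerXn2r ?nnegrE //; apply: le_trans h.
  nra.
rewrite big_split /= -mulr_sumr sumr_const_nat subn1 /= -[X in _ + X <= _]mulr_natl.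
have J20 : 0 <= J%:R ^+ 2 :> R by rewrite sqr_ge0.
have := ler_wpM2l J20 rs; set S := \sum_(_ <= _ < _) _; move: (tail_mass nu) => m.
have -> : J%:R ^+ 2 * (J%:R * m + 4) = J%:R ^+ 3 * m + 4 * J%:R ^+ 2 by ring.
have -> : J%:R * (12 * J%:R) = 12 * J%:R ^+ 2 :> R by ring.
lra.
Qed.

Lemma sum_clip_ge nu : 0 <= nu ->
  J%:R ^+ 3 * tail_mass nu
    <= \sum_(1 <= u < J.+1) pos (2 * J%:R - nu * J%:R ^+ 2 / u%:R) ^+ 2.
Proof.
move=> nu0; have J0 := half_gt0 p_pr p_odd.
have /andP[rs _] := tail_riemann_sum nu0 J0.
have J20 : 0 <= J%:R ^+ 2 :> R by rewrite sqr_ge0.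
have := ler_wpM2l J20 rs; rewrite mulrA -exprSr => /le_trans-> //.
rewrite mulr_sumr; apply: ler_sum => u _.
rewrite -exprMn maxr_pMr ?ler0n // mulr0.
by have -> : 2 * J%:R - nu * J%:R ^+ 2 / u%:R = J%:R * (2 - nu * (J%:R / u%:R)) by ring.
Qed.

Lemma natr_p : p%:R = 2 * J%:R + 1 :> R.
Proof. by rewrite [in LHS](half_double p_pr p_odd) -natr1 -mul2n natrM. Qed.

Lemma centered_diff (j k : nat) :
  (k%:Z - J%:Z)%:~R - (j%:Z - J%:Z)%:~R = k%:R - j%:R :> R.
Proof. by rewrite !rmorphB /= -!pmulrn; ring. Qed.

Lemma sum_over_p (H : int -> R) : \sum_(0 <= i < p) H (i%:Z - J%:Z) =
  H 0 + \sum_(1 <= u < J.+1) (H u%:Z + H (- u%:Z)).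
Proof. by rewrite [X in \sum_(0 <= _ < X) _](half_double p_pr p_odd) sum_centered. Qed.

(* Slicing by u turns the count into pairs (v, w) with w - v >= nu J^2 / u. *)
Lemma card_tilt_le_gt0 nu : 0 < nu ->
  #|tilt nu|%:R <= J%:R ^+ 3 * tail_mass nu + 16 * J%:R ^+ 2.
Proof.
move=> nu0; have J0 := half_gt0 p_pr p_odd; have J0' : 0 < J%:R :> R by rewrite ltr0n.
rewrite (card_symrep_set (fun u v w => nu * J%:R ^+ 2 <= tilt_form u v w)).
pose H (z : int) : R := \sum_(0 <= j < p) \sum_(0 <= k < p)
   (nu * J%:R ^+ 2 <= z%:~R * (k%:R - j%:R))%R%:R.
have -> : \sum_(0 <= i < p) \sum_(0 <= j < p) \sum_(0 <= k < p)
    (nu * J%:R ^+ 2 <= tilt_form (i%:Z - J%:Z) (j%:Z - J%:Z) (k%:Z - J%:Z))%R%:R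
    = \sum_(0 <= i < p) H (i%:Z - J%:Z).
  apply: eq_bigr => i _; apply: eq_bigr => j _; apply: eq_bigr => k _.
  by rewrite /tilt_form centered_diff.
rewrite sum_over_p; have -> : H 0 = 0.
  rewrite /H big1 // => j _; rewrite big1 // => k _.
  by rewrite mul0r leNgt mulr_gt0 // exprn_gt0.
rewrite add0r; apply: le_trans (sum_clip_le (ltW nu0)).
rewrite big_nat [leRHS]big_nat; apply: ler_sum => u /andP[u1 _].
have u0 : 0 < u%:R :> R by rewrite ltr0n.
have d0 : 0 <= nu * J%:R ^+ 2 / u%:R by rewrite divr_ge0 // mulr_ge0 ?sqr_ge0 // ltW.
have := count_pairs_ge_le p d0; rewrite natr_p.
have -> : 2 * J%:R + 1 + 1 - nu * J%:R ^+ 2 / u%:R = 2 * J%:R + 2 - nu * J%:R ^+ 2 / u%:R by ring.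
have -> : H u%:Z = \sum_(0 <= j < p) \sum_(0 <= k < p) (nu * J%:R ^+ 2 / u%:R <= k%:R - j%:R)%R%:R.
  apply: eq_bigr => j _; apply: eq_bigr => k _.
  by rewrite ler_pdivrMr // (mulrC _ u%:R).
(* Changing the sign of u amounts to exchanging v and w, so the two half squares add up to a full
   one. *)
have -> : H (- u%:Z) = \sum_(0 <= j < p) \sum_(0 <= k < p) (nu * J%:R ^+ 2 / u%:R <= k%:R - j%:R)%R%:R.
  rewrite exchange_big; apply: eq_bigr => j _; apply: eq_bigr => k _.
  by rewrite ler_pdivrMr // (mulrC _ u%:R) rmorphN /= -[LHS]/((_ <= - u%:R * _)%R%:R) mulNr -mulrN opprB.
by lra.
Qed.

(** The complement is counted from below: its slices at u and - u are pairs with a difference above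
    - nu J^2 / |u|, and the slice u = 0 is dropped. *)
Lemma card_tilt_le_le0 nu : nu <= 0 ->
  #|tilt nu|%:R <= p%:R ^+ 3 - J%:R ^+ 3 * tail_mass (- nu).
Proof.
move=> nu0; have mu0 : 0 <= - nu by rewrite oppr_ge0.
have J0 := half_gt0 p_pr p_odd; have J0' : 0 < J%:R :> R by rewrite ltr0n.
have := cardsC (tilt nu); rewrite !card_prod !card_Fp // => cC.
have -> : #|tilt nu|%:R = p%:R ^+ 3 - #|~: tilt nu|%:R :> R.
  have -> : p%:R ^+ 3 = (p * p * p)%:R :> R by rewrite !natrM; ring.
  by rewrite -cC natrD addrK.
rewrite lerD2l lerN2.
have -> : (~: tilt nu)%SET = [set r | tilt_form (symrep r.1.1) (symrep r.1.2) (symrep r.2)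
    < nu * J%:R ^+ 2]%SET by apply/finset.setP => r; rewrite !inE ltNge.
rewrite (card_symrep_set (fun u v w => tilt_form u v w < nu * J%:R ^+ 2)).
pose H (z : int) : R := \sum_(0 <= j < p) \sum_(0 <= k < p)
   (z%:~R * (k%:R - j%:R) < nu * J%:R ^+ 2)%R%:R.
have -> : \sum_(0 <= i < p) \sum_(0 <= j < p) \sum_(0 <= k < p)
    (tilt_form (i%:Z - J%:Z) (j%:Z - J%:Z) (k%:Z - J%:Z) < nu * J%:R ^+ 2)%R%:R
    = \sum_(0 <= i < p) H (i%:Z - J%:Z).
  apply: eq_bigr => i _; apply: eq_bigr => j _; apply: eq_bigr => k _.
  by rewrite /tilt_form centered_diff.
rewrite sum_over_p; apply: le_trans (sum_clip_ge mu0) _; rewrite -[leLHS]add0r.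
apply: lerD; first by apply: sumr_ge0 => j _; apply: sumr_ge0 => k _; rewrite ler0n.
rewrite big_nat [leRHS]big_nat; apply: ler_sum => u /andP[u1 _].
have u0 : 0 < u%:R :> R by rewrite ltr0n.
have d0 : 0 <= - nu * J%:R ^+ 2 / u%:R by rewrite divr_ge0 // mulr_ge0 ?sqr_ge0 // ltW.
have := count_pairs_gt_ge p d0; rewrite natr_p addrK.
have -> : H (- u%:Z) = \sum_(0 <= j < p) \sum_(0 <= k < p) (- nu * J%:R ^+ 2 / u%:R < k%:R - j%:R)%R%:R.
  apply: eq_bigr => j _; apply: eq_bigr => k _.
  rewrite ltr_pdivrMr // (mulrC _ u%:R) rmorphN /= -[LHS]/((- u%:R * _ < _)%R%:R).
  by rewrite !mulNr ltrNl.
have -> : H u%:Z = \sum_(0 <= j < p) \sum_(0 <= k < p) (- nu * J%:R ^+ 2 / u%:R < k%:R - j%:R)%R%:R.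
  rewrite exchange_big; apply: eq_bigr => j _; apply: eq_bigr => k _.
  rewrite ltr_pdivrMr // (mulrC _ u%:R) -[LHS]/((u%:R * _ < _)%R%:R).
  by rewrite mulNr ltrNl -mulrN opprB.
by lra.
Qed.

(** 19 = 12 + 6 + 1 comes from (2 J + 1)^3 - 8 J^3 in the case [nu <= 0]. *)
Lemma card_tilt_le nu :
  #|tilt nu|%:R <= 8 * J%:R ^+ 3 * tail_prob nu + 19 * J%:R ^+ 2.
Proof.
have J1 : 1 <= J%:R :> R by rewrite ler1n half_gt0.
have J2 : J%:R <= J%:R ^+ 2 :> R by rewrite expr2 ler_peMl ?ler0n.
case: (ltP 0 nu) => nu0.
  apply: le_trans (card_tilt_le_gt0 nu0) _; rewrite tail_prob_gt0 //.
  have -> : 8 * J%:R ^+ 3 * (tail_mass nu / 8) = J%:R ^+ 3 * tail_mass nu by field.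
  by rewrite lerD2l; lra.
apply: le_trans (card_tilt_le_le0 nu0) _; rewrite tail_prob_le0 // natr_p.
have -> : (2 * J%:R + 1) ^+ 3 - J%:R ^+ 3 * tail_mass (- nu) =
  8 * J%:R ^+ 3 * (1 - tail_mass (- nu) / 8) + (12 * J%:R ^+ 2 + 6 * J%:R + 1) :> R by field.
by rewrite lerD2l; lra.
Qed.

(** The mirror image of [tilt nu] under [swap23]. Large gaps lead to such a region, small gaps to a
    [tilt]. *)
Definition tilt_left nu : {set V} :=
  [set r | tilt_form (symrep r.1.1) (symrep r.1.2) (symrep r.2) <= - nu * J%:R ^+ 2].

Definition swap23 (r : V) : V := (r.1.1, r.2, r.1.2).

Lemma swap23K : involutive swap23. Proof. by case=> [[]]. Qed.

Lemma mem_tilt_left nu r : (r \in tilt_left nu) = (swap23 r \in tilt nu).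
Proof.
rewrite !inE /tilt_form /=; move: (symrep _) (symrep _) (symrep _) => u v w.
by rewrite mulNr lerNr -mulrN opprB.
Qed.

End LatticeCount.

(** * Points of the curve in a tilted region *)

Section GraphTail.
Variable R : realType.
Implicit Types (nu eps : R).

Lemma tail_mass_bounds nu : 0 <= nu -> 0 <= tail_mass nu <= 4.
Proof.
rewrite le_eqVlt => /orP[/eqP<-|nu0]; first by rewrite tail_mass0 lexx andbT.
have [nu2|nu2] := leP 2 nu; first by rewrite tail_mass_ge2 // lexx /=.
have le1 : nu / 2 <= 1 by lra.
have /andP[lo hi] := tail_primitive_bounds nu0 (lexx _) le1.
rewrite /tail_mass max_l //; apply/andP; split.
  by apply: le_trans lo; rewrite mulr_ge0 ?sqr_ge0 // subr_ge0.
apply: le_trans hi _; rewrite divr1; nra.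
Qed.

Lemma tail_prob_ge0 nu : 0 <= tail_prob nu.
Proof.
have m (x : R) : 0 <= Num.max x 0 by rewrite le_max lexx orbT.
have /andP[h1 _] := tail_mass_bounds (m nu); have /andP[_ h2] := tail_mass_bounds (m (- nu)).
by rewrite /tail_prob divr_ge0 //; lra.
Qed.

Section FixedPrime.
Variable p : nat.
Hypotheses (p_pr : prime p) (p_odd : odd p).
Variable L : nat.
Hypothesis Lp : (L <= p)%N.
Local Notation J := (half p).
Local Notation V := ('F_p * 'F_p * 'F_p)%type.
Implicit Types (a b : 'F_p) (r : V).

Lemma sum_lt_indicator : (\sum_(0 <= i < p) (i < L) = L)%N.
Proof.
rewrite (@big_cat_nat _ _ _ L) //= big_nat (eq_bigr (fun=> 1%N)) => [|i /andP[_ ->] //].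
rewrite -big_nat sum_nat_const_nat subn0 muln1 big_nat big1 ?addn0 // => i /andP[Li _].
by rewrite ltnNge Li.
Qed.

Definition short : {set 'F_p} := [set a : 'F_p | (val a < L)%N].

(** The smoothing cube. Its sides start at 0, so adding one of its elements can leave [-J, J] only
    at the top. *)
Definition short_cube : {set V} := finset.setX (finset.setX short short) short.

Lemma card_short : #|short| = L.
Proof.
rewrite -sum1_card big_mkcond /= -[RHS]sum_lt_indicator -(sum_Fp_val p_pr (fun i => (i < L : nat)%N)).
by apply: eq_bigr => a _; rewrite inE; case: (_ < _)%N.
Qed.

Lemma card_short_cube : #|short_cube| = (L ^ 3)%N.
Proof. by rewrite /short_cube !cardsX !card_short !expnS expn0 muln1 mulnA. Qed.

Definition low a := symrep a < L%:Z - J%:Z.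

Lemma card_low : #|[set a | low a]| = L.
Proof.
rewrite -sum1_card big_mkcond /= -[RHS]sum_lt_indicator.
rewrite (eq_bigr (fun a => ((symrep a < L%:Z - J%:Z)%R : nat))) => [|a _]; last first.
  by rewrite inE /low; case: (_ < _).
rewrite (sum_symrep p_pr p_odd (fun z => ((z < L%:Z - J%:Z)%R : nat))).
by apply: eq_bigr => i _; congr nat_of_bool; lia.
Qed.

(* Adding an element of [short_cube] wraps around modulo p only if the result has a
   [low] coordinate. *)
Definition border : {set V} := [set r | [|| low r.1.1, low r.1.2 | low r.2]].

Lemma card_border_le : (#|border| <= 3 * L * p ^ 2)%N.
Proof.
pose T : {set 'F_p} := [set: 'F_p]%SET; pose S := [set a | low a]%SET.
have cT : #|T| = p by rewrite cardsT card_Fp.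
have sub : border \subset finset.setX (finset.setX S T) T :|: finset.setX (finset.setX T S) T
    :|: finset.setX (finset.setX T T) S.
  by apply/fintype.subsetP => -[[u v] w]; rewrite !inE /= !andbT orbA.
apply: leq_trans (subset_leq_card sub) _.
apply: leq_trans (leq_card_setU _ _) _.
apply: leq_trans (leq_add (leq_card_setU _ _) (leqnn _)) _.
by rewrite !cardsX !cT card_low; lia.
Qed.

(** A sum above J is at most J + L - 1, and subtracting p = 2 J + 1 brings it below L - J. *)
Lemma symrep_shift a b : b \in short ->
  low (a + b) \/ symrep (a + b) = symrep a + (val b)%:Z.
Proof.
rewrite inE => bL; have aJ := symrep_bounds p_pr p_odd a.
have pE := half_double p_pr p_odd.
have e : a + b = (symrep a + (val b)%:Z)%:~R.
  by rewrite rmorphD /= symrepK // -pmulrn natr_Zp.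
have [zJ|zJ] := leP (symrep a + (val b)%:Z) J%:Z.
  by right; rewrite e symrep_int //; lia.
left; rewrite /low; have -> : a + b = (symrep a + (val b)%:Z - p%:Z)%:~R.
  by rewrite rmorphB /= -e -pmulrn pcharf0 ?subr0 // pchar_Fp.
by rewrite symrep_int //; lia.
Qed.

(** Without wrapping, moving each coordinate by at most L changes u (w - v) by at most J L + 2 J L,
    and the hypothesis keeps 3 J L below d J^2. *)
Lemma tilt_fattening nu (d : R) : 3 * L%:R <= d * J%:R ->
  forall a b : V, a \in tilt p nu -> b \in short_cube -> a + b \in tilt p (nu - d) :|: border.
Proof.
move=> Ld [[a1 a2] a3] [[b1 b2] b3]; rewrite !inE /= => aT /andP[/andP[B1 B2] B3].
have bnd (x : 'F_p) : `|(symrep x)%:~R| <= J%:R :> R.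
  have /andP[h1 h2] := symrep_bounds p_pr p_odd x.
  rewrite ler_norml; have -> : - J%:R = (- J%:Z)%:~R :> R by rewrite rmorphN.
  by rewrite ler_int h1 /= -[leRHS]/(J%:Z%:~R) ler_int.
have bv (b : 'F_p) : (val b < L)%N -> 0 <= ((val b)%:R : R) <= L%:R.
  by move=> bL; rewrite ler0n ler_nat ltnW.
have inS (b : 'F_p) : (val b < L)%N -> b \in short by rewrite inE.
have [lo|E1] := symrep_shift a1 (inS _ B1); first by rewrite lo !orbT.
have [lo|E2] := symrep_shift a2 (inS _ B2); first by rewrite lo !orbT.
have [lo|E3] := symrep_shift a3 (inS _ B3); first by rewrite lo !orbT.
apply/orP; left; have bu := bnd (a1 + b1); have bv' := bnd (a2 + b2); have bw := bnd (a3 + b3).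
move: bu bv' bw aT; rewrite /tilt_form E1 E2 E3 !rmorphD /= -!pmulrn.
have := bnd a1; have := bv b1 B1; have := bv b2 B2; have := bv b3 B3.
move: ((symrep a1)%:~R) ((symrep a2)%:~R) ((symrep a3)%:~R) => u v w.
move: ((val b1)%:R) ((val b2)%:R) ((val b3)%:R) => x y z.
move=> /andP[z0 zL] /andP[y0 yL] /andP[x0 xL] uJ u'J v'J w'J h.
have h1 : `|u * (z - y)| <= J%:R * L%:R.
  by rewrite normrM ler_pM // ler_norml; lra.
have h2 : `|x * (w + z - (v + y))| <= L%:R * (2 * J%:R).
  rewrite normrM; apply: ler_pM => //; first by rewrite ger0_norm.
  by apply: le_trans (ler_normB _ _) _; lra.
move: h1 h2; rewrite !ler_norml => /andP[h1 _] /andP[h2 _].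
have J0 : 0 <= J%:R :> R by rewrite ler0n.
have := ler_wpM2r J0 Ld; rewrite mulrBl.
have -> : d * J%:R * J%:R = d * J%:R ^+ 2 by ring.
have -> : (u + x) * (w + z - (v + y)) = u * (w - v) + u * (z - y) + x * (w + z - (v + y)) by ring.
lra.
Qed.

(** The 5 rounds up 19 / 4, as 2 J <= p. *)
Lemma card_fattened_le nu : #|tilt p nu :|: border|%:R <=
  p%:R ^+ 2 * (tail_prob nu * p%:R + 5 + 3 * L%:R) :> R.
Proof.
apply: le_trans (_ : #|tilt p nu|%:R + #|border|%:R <= _).
  by rewrite -natrD ler_nat leq_card_setU.
have h1 := card_tilt_le p_pr p_odd nu; have h2 := card_border_le.
have h2' : #|border|%:R <= 3 * L%:R * p%:R ^+ 2 :> R.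
  by rewrite -natrX -!natrM ler_nat.
have J0 : 0 <= J%:R :> R by rewrite ler0n.
have pJ : 2 * J%:R <= p%:R :> R by rewrite (natr_p R p_pr p_odd) lerDl.
have p0 : 0 <= p%:R :> R by rewrite ler0n.
have J3 : (2 * J%:R) ^+ 3 <= p%:R ^+ 3 :> R by rewrite lerXn2r ?nnegrE ?mulr_ge0.
have J2 : (2 * J%:R) ^+ 2 <= p%:R ^+ 2 :> R by rewrite lerXn2r ?nnegrE ?mulr_ge0.
have := ler_wpM2l (tail_prob_ge0 nu) J3.
have -> : tail_prob nu * (2 * J%:R) ^+ 3 = 8 * J%:R ^+ 3 * tail_prob nu by ring.
have -> : p%:R ^+ 2 * (tail_prob nu * p%:R + 5 + 3 * L%:R) =
  tail_prob nu * p%:R ^+ 3 + 5 * p%:R ^+ 2 + 3 * L%:R * p%:R ^+ 2 by ring.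
have e : (2 * J%:R) ^+ 2 = 4 * J%:R ^+ 2 :> R by ring.
move: J2; rewrite e; have := sqr_ge0 (J%:R : R); have := sqr_ge0 (p%:R : R); lra.
Qed.

End FixedPrime.

Lemma curve_tail nu eps : 0 < eps -> exists2 delta, 0 < delta & exists Q : R,
  forall p (h : 'F_p), prime p -> odd p -> h != 0 -> Q <= p%:R ->
  #|[set y | curve h y \in tilt p (nu - delta)]|%:R <= (tail_prob nu + eps) * p%:R /\
  #|[set y | curve h y \in tilt_left p (nu - delta)]|%:R <= (tail_prob nu + eps) * p%:R.
Proof.
move=> eps0; have eps40 : 0 < eps / 4 by lra.
(* [d0] is split in two: one half is the margin granted in the conclusion, the other is lost to the
   fattening. *)
have [d0 d0_gt0 Hd0] := tail_prob_left nu eps40; pose d := d0 / 2.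
have dpos : 0 < d by rewrite divr_gt0.
(* Here [eta] is a real number, not the character. The side L of the cube lies between eta p and 2
   eta p; d / 18 then gives 3 L <= d J through p <= 3 J, and eps / 100 makes the border small. *)
exists d => //; pose eta := Num.min (1 / 2) (Num.min (d / 18) (eps / 100)).
have eta0 : 0 < eta by rewrite !lt_min; apply/and3P; split; lra.
have eta1 : eta <= 1 / 2 by rewrite ge_min lexx.
have eta2 : eta <= d / 18 by rewrite !ge_min lexx !orbT.
have eta3 : eta <= eps / 100 by rewrite !ge_min lexx !orbT.
have [|Q HQ] := @curve_upper_bound R eta; first by rewrite eta0 /=; lra.
exists (`|Q| + eta^-1 + 20 / eps + 3) => p h p_pr p_odd h0 Qp.
have Q0 : 0 <= `|Q| by []; have eV0 : 0 < eta^-1 by rewrite invr_gt0.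
have e20 : 0 < 20 / eps by rewrite divr_gt0.
have p0 : 0 < p%:R :> R by lra.
have QQ : Q <= p%:R by apply: le_trans (ler_norm _) _; lra.
have p_eta : 1 <= eta * p%:R by rewrite mulrC -ler_pdivrMr // div1r; lra.
have p_eps : 20 <= eps * p%:R by rewrite mulrC -ler_pdivrMr //; lra.
pose L := (Num.truncn (eta * p%:R)).+1.
have ep0 : 0 <= eta * p%:R by lra.
have L1 : eta * p%:R <= L%:R by rewrite ltW // truncnS_gt.
have L2 : L%:R <= 2 * (eta * p%:R).
  have /andP[h1 _] := truncn_itv ep0.
  by rewrite /L -(natr1 (Num.truncn _)); lra.
have Lp : (L <= p)%N.
  rewrite -(ler_nat R); apply: le_trans L2 _; have := ler_wpM2r (ltW p0) eta1; lra.
have pJ : p%:R <= 3 * (half p)%:R :> R.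
  have : 1 <= (half p)%:R :> R by rewrite ler1n half_gt0.
  by rewrite (natr_p R p_pr p_odd); lra.
have L3 : 3 * L%:R <= d * (half p)%:R.
  have := ler_wpM2r (ltW p0) eta2; have := ler_wpM2l (ltW dpos) pJ; lra.
have Bc : eta ^+ 3 * p%:R ^+ 3 <= #|short_cube p L|%:R.
  rewrite card_short_cube // natrX -exprMn; apply: lerXn2r; rewrite ?nnegrE //.
pose D := tilt p (nu - d - d) :|: border p L.
have Dle : #|D|%:R / p%:R ^+ 2 + eta * p%:R <= (tail_prob nu + eps) * p%:R.
  have : #|D|%:R / p%:R ^+ 2 <= tail_prob (nu - d - d) * p%:R + 5 + 3 * L%:R.
    by rewrite ler_pdivrMr ?exprn_gt0 // mulrC; apply: card_fattened_le.
  have -> : nu - d - d = nu - d0 by rewrite /d; field.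
  have := ler_wpM2r (ltW p0) Hd0; have := ler_wpM2r (ltW p0) eta3; lra.
have fat := tilt_fattening p_pr p_odd Lp L3 (nu := nu - d).
split; apply: le_trans Dle; first by apply: (HQ p h _ (short_cube p L)).
(* It is the region that is reflected, not the curve: [short_cube] is invariant under [swap23], so
   the fattening carries over. *)
pose D' := (@swap23 p) @^-1: D.
have -> : #|D| = #|D'|.
  by rewrite /D' on_card_preimset //; apply: onW_bij; exists (@swap23 p); exact: swap23K.
apply: (HQ p h _ (short_cube p L)) => // a b; rewrite mem_tilt_left => aT bB.
rewrite finset.inE; apply: (fat (swap23 a) (swap23 b)) => //.
by move: bB; rewrite !inE -!andbA => /and3P[-> -> ->].
Qed.

End GraphTail.

(** * Angles and gaps *)

Section Angles.
Variable R : realType.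
Implicit Types (t u v x : R).

Lemma signed_angle_atan u v : 0 < u -> signed_angle u v = atan (v / u).
Proof.
move=> u0; have pos_case w : 0 <= w ->
    acos (u / Num.sqrt (u ^+ 2 + w ^+ 2)) = atan (w / u).
  move=> w0; have x0 : 0 <= w / u by rewrite divr_ge0 // ltW.
  have -> : u / Num.sqrt (u ^+ 2 + w ^+ 2) = cos (atan (w / u)).
    rewrite cos_atan; have -> : u ^+ 2 + w ^+ 2 = u ^+ 2 * (1 + (w / u) ^+ 2).
      by field; rewrite gt_eqF.
    rewrite sqrtrM ?sqr_ge0 // sqrtr_sqr gtr0_norm // invfM mulrA divff ?mul1r //.
    by rewrite gt_eqF.
  rewrite cosK // in_itv /=; apply/andP; split.
    have [->|ne] := eqVneq (w / u) 0; first by rewrite atan0.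
    by rewrite -(@atan0 R) ltW // lt_atan // lt_neqAle eq_sym ne.
  apply: ltW; apply: lt_trans (atan_ltpi2 _) _; have := pi_gt0 R; lra.
rewrite /signed_angle; case: ltP => v0; last exact: pos_case.
have := pos_case (- v); rewrite oppr_ge0 sqrrN mulNr atanN => -> //; last exact: ltW.
by rewrite opprK.
Qed.

Lemma atan_near x : `|atan x - x| <= `|x| ^+ 3.
Proof.
wlog x0 : x / 0 <= x.
  move=> H; have [/H//|x0] := leP 0 x.
  have := H (- x); rewrite atanN normrN -opprD normrN => -> //; lra.
have [|c] := @MVT_segment R (@atan R) (fun c => (1 + c ^+ 2)^-1) 0 x x0.
- apply: derivable_within_continuous => c _.
  by have [] := is_derive1_atan c.
rewrite in_itv /= atan0 !subr0 => /andP[c0 cx] ->.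
have c2 : 0 <= c ^+ 2 <= x ^+ 2 by rewrite sqr_ge0 lerXn2r ?nnegrE.
have -> : (1 + c ^+ 2)^-1 * x - x = - (x * (c ^+ 2 / (1 + c ^+ 2))).
  by field; rewrite gt_eqF //; lra.
rewrite normrN ger0_norm; last by rewrite mulr_ge0 ?divr_ge0; lra.
rewrite ger0_norm // exprS ler_wpM2l // ler_pdivrMr; last by lra.
by have : 0 <= x ^+ 2 * c ^+ 2 by [rewrite mulr_ge0; lra]; lra.
Qed.

(** Put T = t J^2. The angle is atan z with z = y / (x + T), and T z = y - x y / T + y x^2 / (T (x +
    T)). As T >= 2 J^2, the cubic error of atan costs 2 / J and the last term 1 / J. *)
Lemma view_angle_near t p (X Y : int) : 2 <= t -> (0 < half p)%N ->
  `|X%:~R| <= (half p)%:R :> R -> `|Y%:~R| <= (half p)%:R :> R ->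
  `|t * (half p)%:R ^+ 2 * view_angle t p (X, Y) -
     (Y%:~R - X%:~R * Y%:~R / (t * (half p)%:R ^+ 2))| <= 3 / (half p)%:R.
Proof.
move=> t2 J0; rewrite /view_angle /observer /= opprK subr0.
have j1 : 1 <= (half p)%:R :> R by rewrite ler1n.
move: ((half p)%:R) (X%:~R) (Y%:~R) j1 => j x y j1 xj yj.
have j0 : 0 < j by lra.
have jj : j <= j ^+ 2 by rewrite expr2 ler_peMl // ltW.
have T2 : 2 * j ^+ 2 <= t * j ^+ 2 by rewrite ler_wpM2r // sqr_ge0.
move: T2; set T := t * j ^+ 2 => T2.
have T0 : 0 < T by lra.
clearbody T; move: (xj); rewrite ler_norml => /andP[xj1 xj2].
have D2 : T / 2 <= x + T by lra.
have D0 : 0 < x + T by lra.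
rewrite signed_angle_atan //; set z := y / (x + T).
have zle : `|z| <= j^-1.
  rewrite normrM normfV (gtr0_norm D0) ler_pdivrMr //.
  apply: le_trans yj _; rewrite -(ler_pM2l j0) mulrA divff ?gt_eqF // mul1r -expr2; lra.
have Tz : T * `|z| <= 2 * j.
  rewrite normrM normfV (gtr0_norm D0) mulrA ler_pdivrMr //.
  have := ler_wpM2l (ltW T0) yj; have : j * T <= j * (2 * (x + T)).
    by rewrite ler_pM2l //; lra.
  lra.
have e1 : `|T * (atan z - z)| <= 2 / j.
  rewrite normrM (gtr0_norm T0); apply: le_trans (_ : T * `|z| ^+ 3 <= _).
    by rewrite ler_pM2l // atan_near.
  have -> : T * `|z| ^+ 3 = T * `|z| * `|z| ^+ 2 by ring.
  have -> : 2 / j = 2 * j * j^-1 ^+ 2 by field; rewrite gt_eqF.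
  apply: ler_pM => //; first by rewrite mulr_ge0 // ltW.
  by rewrite lerXn2r ?nnegrE ?invr_ge0 ?(ltW j0).
have e2 : `|T * z - (y - x * y / T)| <= j^-1.
  have -> : T * z - (y - x * y / T) = y * x ^+ 2 / (T * (x + T)).
    by rewrite /z; field; rewrite !gt_eqF.
  have -> : `|y * x ^+ 2 / (T * (x + T))| = `|y| * `|x| ^+ 2 / (T * (x + T)).
    by rewrite normrM normfV (gtr0_norm (mulr_gt0 T0 D0)) [X in X / _]normrM normrX.
  rewrite ler_pdivrMr ?mulr_gt0 //.
  apply: le_trans (_ : j * j ^+ 2 <= _).
    by apply: ler_pM; rewrite ?sqr_ge0 // lerXn2r ?nnegrE ?(ltW j0).
  have h : 2 * j ^+ 2 * j ^+ 2 <= T * (x + T).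
    by apply: ler_pM; rewrite ?mulr_ge0 ?sqr_ge0 //; lra.
  have jv0 : 0 <= j^-1 by rewrite invr_ge0 ltW.
  have := ler_wpM2l jv0 h; have -> : j^-1 * (2 * j ^+ 2 * j ^+ 2) = 2 * (j * j ^+ 2).
    by field; rewrite gt_eqF.
  have : 0 <= j * j ^+ 2 by rewrite mulr_ge0 ?sqr_ge0 // ltW.
  lra.
have -> : T * atan z - (y - x * y / T) = T * (atan z - z) + (T * z - (y - x * y / T)) by ring.
apply: le_trans (ler_normD _ _) _; move: e1 e2; lra.
Qed.

(** Rank counting: the entries from index i on are at least s_i - e, so [size s - i] entries are,
    which forbids a smaller i-th entry after sorting; the other side is symmetric. The sorting
    permutation itself, which may exchange nearly equal angles, never has to be known. *)
Lemma sort_near (s : seq R) (e : R) :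
  (forall i j, (i <= j < size s)%N -> s`_i <= s`_j + e) ->
  forall i, (i < size s)%N -> `|(sort <=%R s)`_i - s`_i| <= e.
Proof.
move=> mono i is_; set a := sort _ s.
have sa : size a = size s by rewrite size_sort.
have srt : sorted <=%R a by apply: sort_sorted; exact: le_total.
have pa : perm_eq a s by rewrite perm_sort.
have ord j k : (j <= k < size s)%N -> a`_j <= a`_k.
  move=> /andP[jk ks]; apply: (sorted_leq_nth le_trans lexx) => //; rewrite inE sa //.
  exact: leq_ltn_trans jk ks.
rewrite ler_distl; apply/andP; split; rewrite leNgt; apply/negP => bad.
- pose P (x : R) := s`_i - e <= x.
  have c1 : (size s - i <= count P s)%N.
    rewrite -(cat_take_drop i s) count_cat; apply: leq_trans (leq_addl _ _).
    rewrite (eqP (_ : count P (drop i s) == size (drop i s))).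
      by rewrite size_drop cat_take_drop.
    rewrite -all_count; apply/(all_nthP 0) => k; rewrite size_drop => ks.
    rewrite nth_drop /P lerBlDr; apply: mono; by rewrite leq_addr /= -ltn_subRL.
  have c2 : (count P a <= size s - i.+1)%N.
    rewrite -(cat_take_drop i.+1 a) count_cat.
    have -> : count P (take i.+1 a) = 0%N.
      apply/eqP; rewrite -leqn0 leqNgt -has_count; apply/(has_nthP 0) => -[k].
      rewrite size_takel ?sa // => ki; rewrite nth_take // /P leNgt => /negP[].
      apply: le_lt_trans bad; apply: ord; lia.
    rewrite add0n; apply: leq_trans (count_size _ _) _; by rewrite size_drop sa.
  have := leq_trans c1 _ ; rewrite -(permP pa P) => /(_ _ c2); lia.
- pose P (x : R) := x <= s`_i + e.
  have c1 : (i.+1 <= count P s)%N.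
    rewrite -(cat_take_drop i.+1 s) count_cat; apply: leq_trans (leq_addr _ _).
    rewrite (eqP (_ : count P (take i.+1 s) == size (take i.+1 s))).
      by rewrite size_takel // cat_take_drop.
    rewrite -all_count; apply/(all_nthP 0) => k; rewrite size_takel // => ki.
    rewrite nth_take // /P; apply: mono; lia.
  have c2 : (count P a <= i)%N.
    rewrite -(cat_take_drop i a) count_cat.
    have -> : count P (drop i a) = 0%N.
      apply/eqP; rewrite -leqn0 leqNgt -has_count; apply/(has_nthP 0) => -[k].
      rewrite size_drop sa => ks; rewrite nth_drop /P leNgt => /negP[].
      apply: lt_le_trans bad _; apply: ord; lia.
    rewrite addn0; apply: leq_trans (count_size _ _) _; by rewrite size_takel // sa ltnW.
  have := leq_trans c1 _ ; rewrite -(permP pa P) => /(_ _ c2); lia.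
Qed.

End Angles.

(** * The points in the order of their ordinates *)

Section Ordinates.
Variables (p : nat) (h : int).
Hypotheses (p_pr : prime p) (p_odd : odd p).
Local Notation J := (half p).
Local Notation hF := (h%:~R : 'F_p).

(** The excluded residues are 0, which is no inverse, and h^-1, which would come from n = 0. *)
Definition ordinate_ok (y : int) := (y%:~R != 0 :> 'F_p) && (y%:~R != hF^-1).

Definition ordinates : seq int :=
  [seq y <- [seq i%:Z - J%:Z | i <- iota 0 p] | ordinate_ok y].

Lemma mem_ordinates y :
  (y \in ordinates) = (- J%:Z <= y <= J%:Z) && ordinate_ok y.
Proof.
rewrite mem_filter andbC; congr (_ && _); have pE := half_double p_pr p_odd.
apply/mapP/idP => [|yJ].
  by case=> k; rewrite mem_iota add0n => /andP[_ kp] ->; lia.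
exists (absz (y + J%:Z)); last by lia.
by rewrite mem_iota; lia.
Qed.

Lemma sorted_ordinates : sorted <%R ordinates.
Proof.
apply: (@sorted_filter _ <%R); first exact: lt_trans.
rewrite sorted_map; apply: sub_sorted (iota_ltn_sorted 0 p) => i j /= ij; lia.
Qed.

Lemma ordinate_lt i j : (i < j)%N -> (j < size ordinates)%N -> ordinates`_i < ordinates`_j.
Proof.
move=> ij js; apply: (sorted_ltn_nth lt_trans) => //; first exact: sorted_ordinates.
by rewrite inE (ltn_trans ij js).
Qed.

Lemma uniq_ordinates : uniq ordinates.
Proof. exact: (sorted_uniq lt_trans (@ltxx _ int) sorted_ordinates). Qed.

Definition abscissa (y : int) : int := symrep (xi hF y%:~R).

Lemma ordinate_bounds j : (j < size ordinates)%N -> - J%:Z <= ordinates`_j <= J%:Z.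
Proof. by move=> /(mem_nth 0); rewrite mem_ordinates => /andP[]. Qed.

Lemma ordinate_span n : (n < size ordinates)%N -> ordinates`_0 + n%:Z <= ordinates`_n.
Proof.
elim: n => [|n IH] ns; first by rewrite addr0.
have := IH (ltnW ns); have := ordinate_lt (ltnSn n) ns; lia.
Qed.

Definition consecutive j := ordinates`_j.+1 == ordinates`_j + 1.

(** An admissible y_j + 1 would be an ordinate, and sortedness would make it the next one. *)
Lemma not_consecutive j : (j.+1 < size ordinates)%N -> ~~ consecutive j ->
  (ordinates`_j + 1)%:~R \in [set 0; hF^-1]%SET.
Proof.
move=> js; apply: contraNT => bad; have j1 := ordinate_lt (ltnSn j) js.
have /andP[lo hi] := ordinate_bounds js.
have /andP[lo' _] := ordinate_bounds (ltnW js).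
have : ordinates`_j + 1 \in ordinates.
  rewrite mem_ordinates /ordinate_ok; move: bad; rewrite !inE negb_or => ->.
  by rewrite andbT; lia.
move=> /(nthP 0)[k ks e]; rewrite /consecutive.
have jk : (j < k)%N.
  rewrite ltnNge; apply/negP; rewrite leq_eqVlt => /orP[/eqP kj|kj].
    by move: e; rewrite kj; move: (_`_j) => a; lia.
  by have := ordinate_lt kj (ltnW js); rewrite e; move: (_`_j) => a; lia.
move: jk; rewrite leq_eqVlt => /orP[/eqP jk|jk]; first by rewrite jk e.
by move: j1; have := ordinate_lt jk ks; rewrite e; move: (_`_j) (_`_j.+1) => a b; lia.
Qed.

(** Consecutive indices inject into [C] through y_j, and the others into the two excluded residues
    through y_j + 1; hence the 2. *)
Lemma gap_count (n : nat) (S : {set 'I_n}) (C : {set 'F_p}) : (n < size ordinates)%N ->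
  (forall j : 'I_n, j \in S -> consecutive j -> (ordinates`_j)%:~R \in C) ->
  (#|S| <= #|C| + 2)%N.
Proof.
move=> ns SC; pose phi (e : int) (j : 'I_n) : 'F_p := (ordinates`_j + e)%:~R.
have inj e : 0 <= e <= 1 -> injective (phi e).
  move=> e01 i j ij; have ls (k : 'I_n) : (k.+1 < size ordinates)%N.
    by apply: leq_ltn_trans ns.
  have bd (k : 'I_n) : - J%:Z <= ordinates`_k + e <= J%:Z.
    have := ordinate_bounds (ls k); have := ordinate_bounds (ltnW (ls k)).
    by have := ordinate_lt (ltnSn k) (ls k); lia.
  have := congr1 (@symrep p) ij; rewrite !symrep_int // => /addIr/eqP.
  rewrite nth_uniq ?uniq_ordinates ?(ltnW (ls _)) // => /eqP; exact: val_inj.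
have cS : (#|S :&: [set j : 'I_n | consecutive j]%SET| <= #|C|)%N.
  rewrite -(card_imset _ (inj 0 isT)); apply: subset_leq_card.
  apply/fintype.subsetP => y /imsetP[j]; rewrite !inE => /andP[jS jc] ->.
  by rewrite /phi addr0; apply: SC.
have cN : (#|S :\: [set j : 'I_n | consecutive j]%SET| <= 2)%N.
  apply: (@leq_trans #|[set 0; hF^-1]%SET|); last by rewrite cards2; case: (_ != _).
  rewrite -(card_imset _ (inj 1 isT)); apply: subset_leq_card.
  apply/fintype.subsetP => y /imsetP[j]; rewrite finset.in_setD => /andP[jc _] ->.
  by apply: not_consecutive; [apply: leq_ltn_trans ns|move: jc; rewrite inE].
by rewrite -(cardsID [set j : 'I_n | consecutive j]%SET S) leq_add.
Qed.

Hypothesis h_neq0 : hF != 0.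

Lemma perm_points : perm_eq (points p h) [seq (abscissa y, y) | y <- ordinates].
Proof.
apply: uniq_perm; first exact: points_uniq.
  by rewrite map_inj_uniq ?uniq_ordinates // => x y [].
move=> [X Y]; apply/mapP/mapP => -[].
  move=> n; rewrite mem_filter mem_enum => /andP[/andP[n0 nh] _] [-> ->].
  exists (symrep (n + h%:~R)^-1).
    rewrite mem_ordinates symrep_bounds //= /ordinate_ok symrepK //.
    rewrite invr_eq0 nh /=; apply: contraNneq n0 => /invr_inj/eqP.
    by rewrite -subr_eq0 addrK.
  congr (_, _); rewrite /abscissa symrepK // xiE ?invr_eq0 //.
    by rewrite invrK addrK.
  by apply: contraNneq n0 => /invr_inj/eqP; rewrite -subr_eq0 addrK.
move=> y; rewrite mem_ordinates => /andP[yJ /andP[y0 yh]] [-> ->].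
exists ((y%:~R)^-1 - hF).
  rewrite mem_filter mem_enum !subr_eq0 subrK invr_eq0 y0 !andbT.
  by apply: contraNneq yh => <-; rewrite invrK.
by rewrite subrK invrK /abscissa xiE // symrep_int.
Qed.

Lemma size_ordinates : size ordinates = (p - 2)%N.
Proof.
by rewrite -(size_points p_pr h_neq0) (perm_size perm_points) size_map.
Qed.

End Ordinates.

(** * Gaps expressed through the curve *)

Section GapEstimates.
Variables (R : realType) (t : R) (p : nat) (h : int).
Hypotheses (t_ge2 : 2 <= t) (p_pr : prime p) (p_odd : odd p).
Local Notation J := (half p).
Local Notation j := ((half p)%:R : R).
Local Notation hF := (h%:~R : 'F_p).
Hypotheses (h_neq0 : hF != 0) (J18 : (18 <= half p)%N).
Local Notation ys := (ordinates p h).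
Local Notation alpha := (angles t p h).

Local Notation T := (t * j ^+ 2).

(* [t * half p ^ 2] times the angle of the point of ordinate [y], up to O(1 / J). *)
Definition model (y : int) : R := y%:~R - (abscissa p h y)%:~R * y%:~R / T.

Lemma half_ge18 : 18 <= j. Proof. by rewrite (ler_nat R 18). Qed.

Lemma scale_ge : 2 * j ^+ 2 <= T. Proof. by rewrite ler_wpM2r // sqr_ge0. Qed.

Lemma scale_gt0 : 0 < T.
Proof.
apply: lt_le_trans scale_ge; have := half_ge18 => h18.
by rewrite mulr_gt0 ?exprn_gt0 //; lra.
Qed.

Lemma scale_divK x : T * (x / T) = x.
Proof. by rewrite mulrC divfK ?gt_eqF ?scale_gt0. Qed.

Lemma symrep_le (a : 'F_p) : `|(symrep a)%:~R| <= j.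
Proof.
have /andP[h1 h2] := symrep_bounds p_pr p_odd a.
rewrite ler_norml; have -> : - j = (- J%:Z)%:~R by rewrite rmorphN.
by rewrite ler_int h1 /= -[leRHS]/(J%:Z%:~R) ler_int.
Qed.

Lemma ordinate_le (y : int) : - J%:Z <= y <= J%:Z -> `|y%:~R| <= j.
Proof. by move=> yJ; have := symrep_le y%:~R; rewrite symrep_int. Qed.

(** This is where t >= 2 decides: |x y| <= J^2 <= T / 2, so [model] moves no integer by more than
    1/2 and keeps distinct ones in order. *)
Lemma model_near (y : int) : - J%:Z <= y <= J%:Z -> `|model y - y%:~R| <= 1 / 2.
Proof.
move=> yJ; rewrite /model addrAC subrr add0r normrN normrM normfV (gtr0_norm scale_gt0).
rewrite ler_pdivrMr ?scale_gt0 // normrM.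
apply: le_trans (_ : j * j <= _); last by have := scale_ge; lra.
by apply: ler_pM => //; [exact: symrep_le|exact: ordinate_le].
Qed.

Lemma model_mono i k : (i <= k < size ys)%N -> model ys`_i <= model ys`_k.
Proof.
move=> /andP[]; rewrite leq_eqVlt => /orP[/eqP->//|ik] ks.
have := model_near (ordinate_bounds p_pr p_odd ks).
have := model_near (ordinate_bounds p_pr p_odd (ltn_trans ik ks)).
have : (ys`_i + 1)%:~R <= (ys`_k)%:~R :> R.
  by rewrite ler_int; have := ordinate_lt p_pr p_odd ik ks; rewrite -lezD1.
rewrite rmorphD /= !ler_norml; lra.
Qed.

Lemma angle_near i : (i < size ys)%N -> `|T * alpha`_i - model ys`_i| <= 9 / j.
Proof.
move=> is_; pose s := [seq view_angle t p (abscissa p h y, y) | y <- ys].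
have sE : alpha = sort <=%R s.
  rewrite /angles; apply/perm_sortP; [exact: le_total|exact: le_trans|exact: le_anti|].
  by rewrite /s (map_comp (view_angle t p) (fun y => (abscissa p h y, y))) perm_map // perm_points.
have ss : size s = size ys by rewrite size_map.
have near k : (k < size ys)%N -> `|T * s`_k - model ys`_k| <= 3 / j.
  move=> ks; rewrite (nth_map 0) //; apply: view_angle_near => //.
  - exact: half_gt0.
  - exact: symrep_le.
  - exact: ordinate_le (ordinate_bounds p_pr p_odd ks).
have j18 := half_ge18; have j0 : 0 < j by lra.
(* Twice the error 3 / j, since [model] itself is monotone; sorting adds these 6 to the 3, whence
   9. *)
have mono k l : (k <= l < size s)%N -> s`_k <= s`_l + 6 / j / T.
  rewrite ss => kl; have /andP[kl1 ls] := kl.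
  rewrite -(ler_pM2l scale_gt0) mulrDr scale_divK.
  have := near l ls; have := near k (leq_ltn_trans kl1 ls); have := model_mono kl.
  by rewrite !ler_norml; lra.
have := sort_near mono; rewrite -sE ss => /(_ i is_) srt.
have := ler_wpM2l (ltW scale_gt0) srt; rewrite scale_divK.
rewrite -{1}(gtr0_norm scale_gt0) -normrM mulrBr; have := near i is_.
by rewrite !ler_norml; lra.
Qed.

Local Definition form (a : 'F_p) : R :=
  tilt_form R (symrep a) (symrep (xi hF a)) (symrep (xi hF (a + 1))).

(** 19 = 9 + 9 + 1: two angle errors, and the term [xi (y + 1)] / T by which the difference of the
    models departs from 1 - form / T. *)
Lemma gap_near i : (i.+1 < size ys)%N -> consecutive p h i ->
  `|T * (alpha`_i.+1 - alpha`_i) - (1 - form (ys`_i)%:~R / T)| <= 19 / j.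
Proof.
move=> is_ /eqP ci; have j18 := half_ge18; have j0 : 0 < j by lra.
have := angle_near is_; have := angle_near (ltnW is_).
have := symrep_le (xi hF ((ys`_i)%:~R + 1)).
have e : model ys`_i.+1 - model ys`_i = 1 - form (ys`_i)%:~R / T
    - (symrep (xi hF ((ys`_i)%:~R + 1)))%:~R / T.
  rewrite ci /model /form /tilt_form /abscissa !rmorphD /= !mulr1z symrep_int //; last first.
    by apply: (ordinate_bounds p_pr p_odd); exact: ltnW.
  have : T != 0 by rewrite gt_eqF ?scale_gt0.
  by move: T => S S0; field.
set w := (symrep _)%:~R in e * => wj.
have : `|w / T| <= 1 / j.
  rewrite normrM normfV (gtr0_norm scale_gt0) ler_pdivrMr ?scale_gt0 //.
  apply: le_trans wj _; have jv : 0 <= 1 / j by rewrite divr_ge0 // ltW.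
  have := ler_wpM2l jv scale_ge; have -> : 1 / j * (2 * j ^+ 2) = 2 * j by field; rewrite gt_eqF.
  lra.
by rewrite mulrBr !ler_norml; move: e; lra.
Qed.

Lemma size_points_sub1 : (size (points p h)).-1 = (2 * J - 2)%N.
Proof.
by rewrite (size_points p_pr h_neq0) {1}(half_double p_pr p_odd) -mul2n; lia.
Qed.

(** With n = 2 J - 2, the n + 1 distinct ordinates lie in an interval of length n + 2, so the
    extreme ones differ by n to n + 2. Passing to models costs 1 and to angles 18 / j <= 1, which
    uses J >= 18; the total of 4 is divided by n >= j. *)
Lemma average_near : `|T * average_gap t p h - 1| <= 4 / j.
Proof.
have j18 := half_ge18; have j0 : 0 < j by lra.
have n1 : ((size (points p h)).-1 < size ys)%N.
  rewrite (size_ordinates p_pr p_odd h_neq0) size_points_sub1.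
  by have := half_double p_pr p_odd; move: J18; lia.
rewrite /average_gap; set n := (size _).-1 in n1 *.
have nE : n%:R = 2 * j - 2 :> R.
  by rewrite /n size_points_sub1 natrB ?natrM //; lia.
have n0 : 0 < n%:R :> R by rewrite nE; lra.
have z0 : (0 < size ys)%N by apply: leq_ltn_trans n1.
have := angle_near n1; have := angle_near z0.
have b0 := ordinate_bounds p_pr p_odd z0; have bn := ordinate_bounds p_pr p_odd n1.
have := model_near b0; have := model_near bn.
have := ordinate_le b0; have := ordinate_le bn.
have : (ys`_0)%:~R + n%:R <= (ys`_n)%:~R :> R.
  have := ordinate_span p_pr p_odd n1; rewrite -(ler_int R) rmorphD /= -pmulrn //.
have j1 : 18 / j <= 1 by rewrite ler_pdivrMr //; lra.
move: (alpha`_n) (alpha`_0) ((ys`_n)%:~R) ((ys`_0)%:~R) (model ys`_n) (model ys`_0) => an a0 yn y0 mn m0.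
rewrite mulrA => H1 H2 H3 H4 H5 H6 H7.
have -> : T * (an - a0) / n%:R - 1 = (T * an - T * a0 - n%:R) / n%:R by field; rewrite gt_eqF ?scale_gt0.
rewrite normrM normfV (gtr0_norm n0) ler_pdivrMr //.
have : 4 <= 4 / j * n%:R.
  rewrite nE mulrBr mulrCA -!mulrA mulVf ?gt_eqF ?scale_gt0 //; lra.
move: H2 H3 H4 H5 H6 H7; rewrite !ler_norml; lra.
Qed.

Variable lambda : R.
Hypothesis lambda_ge0 : 0 <= lambda.
Variable delta : R.
Hypothesis j_large : t * (19 + 4 * lambda) <= delta * j.

Local Notation nu := (t * (lambda - 1)).

(** 19 / j is the error of a gap and 4 lambda / j that of lambda times the average gap; after
    scaling by T both fit in the margin [delta]. *)
Lemma margin_le : T * (19 + 4 * lambda) / j <= delta * j ^+ 2.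
Proof.
have j18 := half_ge18; have j0 : 0 < j by lra.
have -> : T * (19 + 4 * lambda) / j = t * (19 + 4 * lambda) * j.
  by field; rewrite gt_eqF ?scale_gt0.
by rewrite expr2 mulrA ler_pM2r.
Qed.

Lemma large_gap_tilt i : (i.+1 < size ys)%N -> consecutive p h i ->
  lambda * average_gap t p h <= alpha`_i.+1 - alpha`_i ->
  curve hF (ys`_i)%:~R \in tilt_left p (nu - delta).
Proof.
move=> is_ ci; rewrite -(ler_pM2l scale_gt0) mulrCA inE /= -/(form (ys`_i)%:~R) => big.
have j18 := half_ge18; have j0 : 0 < j by lra.
have := gap_near is_ ci; have /andP[lo _] : - (4 / j) <= T * average_gap t p h - 1 <= 4 / j.
  by rewrite -ler_norml average_near.
rewrite ler_norml => /andP[_ hi].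
have h1 := ler_wpM2l lambda_ge0 lo; have := margin_le.
have fT : form (ys`_i)%:~R = T * (form (ys`_i)%:~R / T) by rewrite scale_divK.
have key : form (ys`_i)%:~R / T <= 1 - lambda + (19 + 4 * lambda) / j by lra.
rewrite fT; have := ler_wpM2l (ltW scale_gt0) key.
have -> : T * (1 - lambda + (19 + 4 * lambda) / j) =
  T * (1 - lambda) + T * (19 + 4 * lambda) / j by ring.
have -> : - (nu - delta) * j ^+ 2 = T * (1 - lambda) + delta * j ^+ 2 by ring.
lra.
Qed.

Lemma small_gap_tilt i : (i.+1 < size ys)%N -> consecutive p h i ->
  alpha`_i.+1 - alpha`_i < lambda * average_gap t p h ->
  curve hF (ys`_i)%:~R \in tilt p (- nu - delta).
Proof.
move=> is_ ci; rewrite -(ltr_pM2l scale_gt0) [ltRHS]mulrCA inE /= -/(form (ys`_i)%:~R) => small.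
have j18 := half_ge18; have j0 : 0 < j by lra.
have := gap_near is_ ci; have /andP[_ lo] : - (4 / j) <= T * average_gap t p h - 1 <= 4 / j.
  by rewrite -ler_norml average_near.
rewrite ler_norml => /andP[hi _].
have h1 := ler_wpM2l lambda_ge0 lo; have := margin_le.
have fT : form (ys`_i)%:~R = T * (form (ys`_i)%:~R / T) by rewrite scale_divK.
have key : 1 - lambda - (19 + 4 * lambda) / j <= form (ys`_i)%:~R / T by lra.
rewrite fT; have := ler_wpM2l (ltW scale_gt0) key.
have -> : T * (1 - lambda - (19 + 4 * lambda) / j) =
  T * (1 - lambda) - T * (19 + 4 * lambda) / j by ring.
have -> : (- nu - delta) * j ^+ 2 = T * (1 - lambda) - delta * j ^+ 2 by ring.
lra.
Qed.

(** p - 3 is the number N - 1 of gaps, and each 2 pays for the gaps that jump over an excluded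
    ordinate. *)
Lemma gap_distribution_bounds :
  gap_distribution t p h lambda * (p%:R - 3)
    <= #|[set y | curve hF y \in tilt_left p (nu - delta)]|%:R + 2 /\
  (1 - gap_distribution t p h lambda) * (p%:R - 3)
    <= #|[set y | curve hF y \in tilt p (- nu - delta)]|%:R + 2.
Proof.
have n1 : ((size (points p h)).-1 < size ys)%N.
  rewrite (size_ordinates p_pr p_odd h_neq0) size_points_sub1.
  by have := half_double p_pr p_odd; move: J18; lia.
have nE : (size (points p h)).-1%:R = p%:R - 3 :> R.
  by rewrite size_points_sub1 (natr_p R p_pr p_odd) natrB ?natrM; [ring|lia].
rewrite /gap_distribution; set n := (size _).-1 in n1 nE *.
set G := [set j : 'I_n | _]%SET.
have n0 : n%:R != 0 :> R by rewrite pnatr_eq0 /n size_points_sub1; lia.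
rewrite -nE divfK // mulrBl mul1r divfK //.
have <- : #|~: G|%:R = n%:R - #|G|%:R :> R.
  have /(congr1 (fun k => k%:R : R)) := cardsC G; rewrite card_ord natrD; lra.
rewrite -!natrD !ler_nat; split.
  apply: (gap_count p_pr p_odd n1) => i iG ci; rewrite inE; move: iG; rewrite inE => big.
  apply: large_gap_tilt => //; exact: leq_ltn_trans n1.
apply: (gap_count p_pr p_odd n1) => i iG ci; rewrite inE; move: iG; rewrite 2!inE -ltNge => small.
apply: small_gap_tilt => //; exact: leq_ltn_trans n1.
Qed.

End GapEstimates.

(** * Passage to the limit *)

Local Open Scope classical_set_scope.

Lemma gap_distribution_cvg (R : realType) (t lambda : R) (h : int) :
  2 <= t -> 0 <= lambda -> h != 0 ->
  gap_distribution t p h lambda @[p --> within [set q | prime q] \oo]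
    --> tail_prob (t * (lambda - 1)).
Proof.
move=> t2 l0 h0; set nu := t * (lambda - 1).
apply/cvgrPdist_le => eps eps0; have e40 : 0 < eps / 4 by lra.
have [d1 d10 [Q1 H1]] := curve_tail nu e40.
have [d2 d20 [Q2 H2]] := curve_tail (- nu) e40.
pose c := t * (19 + 4 * lambda).
have c0 : 0 < c by rewrite mulr_gt0 //; lra.
(* The summands secure the two equidistribution thresholds, J >= 18 with p odd, the two margins
   (through p <= 3 J), p not dividing h, and additive errors small against eps p. *)
pose K := `|Q1| + `|Q2| + 40 + 3 * (c / d1) + 3 * (c / d2) + (absz h)%:R + 100 / eps.
rewrite near_withinE; exists (Num.truncn K).+1 => // p /= Kp p_pr.
have {}Kp : K <= p%:R.
  by apply: le_trans (_ : (Num.truncn K).+1%:R <= _); [rewrite ltW // truncnS_gt|rewrite ler_nat].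
have k1 : 0 < c / d1 by rewrite divr_gt0.
have k2 : 0 < c / d2 by rewrite divr_gt0.
have k3 : 0 < 100 / eps by rewrite divr_gt0.
have k4 : 0 <= (absz h)%:R :> R by rewrite ler0n.
have k5 := normr_ge0 Q1; have k6 := normr_ge0 Q2.
have k7 := ler_norm Q1; have k8 := ler_norm Q2.
have p40 : 40 <= p%:R :> R by move: Kp; rewrite /K; lra.
have p40n : (40 <= p)%N by rewrite -(ler_nat R).
have hp : (absz h < p)%N by rewrite -(ltr_nat R); move: Kp; rewrite /K; lra.
have p_odd : odd p by case: (even_prime p_pr) p40n => // ->.
have hF0 : h%:~R != 0 :> 'F_p.
  apply/negP => hF; have : (p %| absz h)%N.
    rewrite (dvdn_pcharf (pchar_Fp p_pr)); move: hF.
    by case: (h) => n; rewrite ?NegzE ?mulrNz ?oppr_eq0 ?abszN -pmulrn.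
  by move=> /dvdn_leq; rewrite lt0n absz_eq0 h0 leqNgt hp => /(_ isT).
have pj := natr_p R p_pr p_odd.
have J18 : (18 <= half p)%N by move: p40n (half_double p_pr p_odd); clear; lia.
have jl d : 0 < d -> 3 * (c / d) <= p%:R -> c <= d * (half p)%:R.
  move=> d0 pd; have h1 : c / d <= (half p)%:R by lra.
  by rewrite mulrC -ler_pdivrMr.
have [|b1 _] := gap_distribution_bounds t2 p_pr p_odd hF0 J18 l0 (delta := d1).
  by apply: jl => //; move: Kp; rewrite /K; lra.
have [|_ b2] := gap_distribution_bounds t2 p_pr p_odd hF0 J18 l0 (delta := d2).
  by apply: jl => //; move: Kp; rewrite /K; lra.
have [|_ u1] := H1 p _ p_pr p_odd hF0; first by move: Kp; rewrite /K; lra.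
have [|u2 _] := H2 p _ p_pr p_odd hF0; first by move: Kp; rewrite /K; lra.
have tN := tail_probN nu; have t0 := tail_prob_ge0 nu; have t0' := tail_prob_ge0 (- nu).
have pe : 100 <= eps * p%:R.
  by rewrite mulrC -ler_pdivrMr //; move: Kp; rewrite /K; lra.
have pe' : eps * 40 <= eps * p%:R by rewrite ler_pM2l.
have p3 : 0 < p%:R - 3 :> R by lra.
move: (le_trans b1 (lerD u1 (lexx 2))) (le_trans b2 (lerD u2 (lexx 2))).
set G := gap_distribution _ _ _ _ => B1 B2.
rewrite ler_norml -(ler_pM2r p3) -[X in _ && X](ler_pM2r p3).
(* Turns the upper bound on the proportion of small gaps into the missing lower bound on [G]. *)
have tp : tail_prob (- nu) = 1 - tail_prob nu by lra.
move: B1 B2; rewrite tp; move: (tail_prob nu) t0 t0' tp => tau *.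
by apply/andP; split; lra.
Qed.

Theorem corollary1 (R : realType) (t lambda : R) (h : int)
    (t_ge2 : 2 <= t) (lambda_ge0 : 0 <= lambda) (h_neq0 : h != 0) :
  [/\ lambda <= 1 - 2 / t ->
        gap_distribution t p h lambda @[p --> within [set q | prime q] \oo]
          --> (1 : R),
      1 - 2 / t <= lambda < 1 ->
        gap_distribution t p h lambda @[p --> within [set q | prime q] \oo]
          --> 1 / 8 * (4 + t ^+ 2 - 2 * lambda * t ^+ 2 + lambda ^+ 2 * t ^+ 2
                + 4 * t * (1 - lambda) * ln (2 / (t * (1 - lambda)))),
      1 <= lambda < 1 + 2 / t ->
        gap_distribution t p h lambda @[p --> within [set q | prime q] \oo]
          --> 1 / 8 * (4 - t ^+ 2 + 2 * lambda * t ^+ 2 - lambda ^+ 2 * t ^+ 2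
                - 4 * t * (lambda - 1) * ln (2 / (t * (lambda - 1)))) &
      1 + 2 / t <= lambda ->
        gap_distribution t p h lambda @[p --> within [set q | prime q] \oo]
          --> (0 : R) ].
Proof.
have t0 : 0 < t by lra.
have cvg := gap_distribution_cvg t_ge2 lambda_ge0 h_neq0.
have tt : t * (2 / t) = 2 by rewrite mulrCA divff ?mulr1 // gt_eqF.
have nuE : - (t * (lambda - 1)) = t * (1 - lambda) by ring.
split=> [l1|/andP[l1 l2]|/andP[l1 l2]|l1].
- have := ler_wpM2l (ltW t0) l1; rewrite mulrBr tt mulr1 => h1.
  suff <- : tail_prob (t * (lambda - 1)) = 1 by [].
  rewrite tail_prob_le0 ?nuE ?tail_mass_ge2; lra.
- have := ler_wpM2l (ltW t0) l1; rewrite mulrBr tt mulr1 => h1.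
  have h2 : 0 < t * (1 - lambda) by rewrite mulr_gt0 // subr_gt0.
  suff <- : tail_prob (t * (lambda - 1)) = 1 / 8 * (4 + t ^+ 2 - 2 * lambda * t ^+ 2
    + lambda ^+ 2 * t ^+ 2 + 4 * t * (1 - lambda) * ln (2 / (t * (1 - lambda)))) by [].
  rewrite tail_prob_le0 ?nuE ?tail_mass_le2; [|lra|lra].
  by move: (ln _) => L; field.
- have h1 : t * (lambda - 1) < 2.
    by rewrite -[ltRHS]tt ltr_pM2l //; lra.
  suff <- : tail_prob (t * (lambda - 1)) = 1 / 8 * (4 - t ^+ 2 + 2 * lambda * t ^+ 2
    - lambda ^+ 2 * t ^+ 2 - 4 * t * (lambda - 1) * ln (2 / (t * (lambda - 1)))) by [].
  move: l1; rewrite le_eqVlt => /orP[/eqP <-|l1].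
    (* At lambda = 1 the logarithm is multiplied by 0, whatever its value, and both sides are
       1/2. *)
    by rewrite subrr mulr0 tail_prob_le0 // oppr0 tail_mass0 mulr0 mul0r; field.
  have h2 : 0 < t * (lambda - 1) by rewrite mulr_gt0 // subr_gt0.
  rewrite tail_prob_gt0 // tail_mass_le2; last by rewrite h2 ltW.
  by move: (ln _) => L; field.
- have h1 : 2 <= t * (lambda - 1) by rewrite -[leLHS]tt ler_pM2l //; lra.
  suff <- : tail_prob (t * (lambda - 1)) = 0 by [].
  by rewrite tail_prob_gt0 ?tail_mass_ge2 ?mul0r //; lra.
Qed.
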